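(* Let $1\leq k\leq n-1$, $m=n-k$, and let $X=G(k,n)$ be the Grassmannian of $k$-dimensional linear subspaces of $\mathbb{C}^n$, with Schubert classes $\sigma_\lambda\in H^*(X,\mathbb{Z})$ indexed by partitions $\lambda\subset (m^k)$. For all partitions $\lambda,\mu,\nu\subset (m^k)$, the constant $c(\lambda,\mu;\nu)$, i.e. the number of Littlewood-Richardson tableaux of shape $\lambda^\vee/\mu$ with content $\nu^\vee$ (taken to be $0$ if $\mu\not\subset\lambda^\vee$), is the coefficient of $\sigma_\nu$ in the expansion of the cup product $\sigma_\lambda\cdot\sigma_\mu$ in the basis of Schubert classes.
   Context: $(m^k)$ denotes the rectangular Young diagram with $k$ rows of length $m$; a partition $\lambda\subset(m^k)$ is written $\lambda=(\lambda_1\geq\dots\geq\lambda_k)$ with $0\leq\lambda_i\leq m$. The dual partition is $\lambda^\vee=(m-\lambda_k,\dots,m-\lambda_1)$. Schubert classes: for a fixed complete flag $F_\bullet$ of $\mathbb{C}^n$, $\sigma_\lambda\in H^{2|\lambda|}(X,\mathbb{Z})$ is the class dual to the Schubert variety $\{V\in X:\dim(V\cap F_{m+i-\lambda_i})\geq i \text{ for } 1\leq i\leq k\}$. The $\sigma_\lambda$ for $\lambda\subset(m^k)$ form a $\mathbb{Z}$-basis of $H^*(X,\mathbb{Z})$. They satisfy the (known) Pieri rule: for each $p\leq m$, $\sigma_p\cdot\sigma_\lambda=\sum\sigma_{\widetilde\lambda}$, the sum over all partitions $\widetilde\lambda\subset(m^k)$ obtained from $\lambda$ by adding a horizontal strip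 with $p$ boxes (a set of $p$ boxes with no two in the same column); here $\sigma_p=\sigma_{(p)}$. The paper's treatment takes as granted only that the $\sigma_\lambda$ form a basis and that the Pieri rule holds. A tableau $T$ of skew shape $\lambda/\mu$ is a filling of the boxes of $\lambda/\mu$ with positive integers such that the entries are weakly increasing along each row and strictly increasing down each column. The content of $T$ is the sequence whose $i$th element is the number of boxes of $T$ containing $i$ (compared with partitions up to trailing zeros). The word $w(T)$ is the sequence obtained by reading the entries of $T$ from right to left in successive rows, starting with the top row. A word $w_1\ldots w_r$ is a lattice word if for all $i\geq 1$ and $1\leq j\leq r$ the number of occurrences of $i$ among $w_1\ldots w_j$ is not less than the number of occurrences of $i+1$. $T$ is a Littlewood-Richardson tableau if $w(T)$ is a lattice word. *)

(* Defs.v *)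
From HB Require Import structures.
From mathcomp Require Import all_boot all_order all_algebra.
From mathcomp Require Import ring_quotient complex.
From mathcomp Require Import boolp classical_sets functions reals topology normedtype.

Set Implicit Arguments.
Unset Strict Implicit.
Unset Printing Implicit Defensive.

Import Order.TTheory GRing.Theory Num.Theory.
Import numFieldNormedType.Exports.

Local Open Scope classical_set_scope.
Local Open Scope ring_scope.
Local Open Scope quotient_scope.

(* Integral singular cohomology, as a ring.  The ring structure of [cochain] is
   the (non-commutative) Alexander-Whitney cup product, not the pointwise one
   carried by a bare function type. *)
Section Singular.
Variables (R : realType) (T : topologicalType).

Definition std_simplex (p : nat) : set 'rV[R]_p.+1 :=
  [set t | (forall i, 0 <= t 0 i) /\ \sum_i t 0 i = 1].

Arguments std_simplex : clear implicits.

Definition vertex_row (q p : nat) (f : 'I_q.+1 -> 'I_p.+1) (t : 'rV[R]_q.+1) :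
  'rV[R]_p.+1 := \row_j \sum_(i | f i == j) t 0 i.

Lemma vertex_row_simplex q p (f : 'I_q.+1 -> 'I_p.+1) (t : std_simplex q) :
  vertex_row f (val t) \in std_simplex p.
Proof.
case: t => t /= /set_mem[t0 t1]; apply/mem_set; split=> [j|].
  by rewrite mxE sumr_ge0.
rewrite -t1 (partition_big f xpredT) //=.
by apply: eq_bigr => j _; rewrite mxE.
Qed.

(* The affine map sending the i-th vertex to the (f i)-th one. *)
Definition vertex_map (q p : nat) (f : 'I_q.+1 -> 'I_p.+1) (t : std_simplex q) :
  std_simplex p := exist (fun u => u \in std_simplex p) _ (vertex_row_simplex f t).

Lemma vertex_map_continuous q p (f : 'I_q.+1 -> 'I_p.+1) :
  continuous (vertex_map f).
Proof.
apply: continuous_comp_initial => t A [P nP PA].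
have coordC i : continuous (fun u : std_simplex q => val u 0 i : R).
  move=> u; apply: (@continuous_comp (std_simplex q) 'rV[R]_q.+1 R
    (fun v => val v) (fun M : 'rV[R]_q.+1 => M 0 i)).
    exact: (@initial_continuous _ _ (fun v : std_simplex q => val v)).
  exact: coord_continuous.
have sumC (r : seq 'I_q.+1) (j : 'I_p.+1) :
    continuous (fun u : std_simplex q => \sum_(i <- r | f i == j) val u 0 i : R).
  elim: r => [|i r IHr] u.
    under [X in continuous_at _ X]eq_fun do rewrite big_nil; exact: cst_continuous.
  under [X in continuous_at _ X]eq_fun do rewrite big_cons.
  by case: ifP => _; [apply: continuousD; [exact: coordC|exact: IHr]|exact: IHr].
have nQ j : nbhs t [set u : std_simplex q | P 0 j (vertex_row f (val u) 0 j)].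
  have -> : [set u : std_simplex q | P 0 j (vertex_row f (val u) 0 j)] =
      (fun u : std_simplex q => \sum_(i | f i == j) val u 0 i : R) @^-1` P 0 j.
    by apply/funext => u; rewrite /= mxE.
  by apply: sumC; move: (nP 0 j); rewrite /= mxE.
have : \forall u \near t, forall j, P 0 j (vertex_row f (val u) 0 j).
  exact: (filter_forall (nbhs_filter t) nQ).
by apply: filterS => u Qu; apply: PA => i j; rewrite ord1; exact: Qu.
Qed.

HB.instance Definition _ q p (f : 'I_q.+1 -> 'I_p.+1) :=
  @isContinuous.Build _ _ (vertex_map f) (@vertex_map_continuous q p f).

Definition simplex (p : nat) := continuousType (std_simplex p) T.

Definition face (p q : nat) (s : simplex p) (f : 'I_q.+1 -> 'I_p.+1) :
  simplex q := s \o vertex_map f.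

(* Cochains of all degrees at once: an element of the product of the C^p. *)
Definition cochain := {p : nat & simplex p} -> int.
HB.instance Definition _ := GRing.Zmodule.on cochain.

Definition value (a : cochain) (p : nat) (s : simplex p) : int := a (existT _ p s).

Definition coboundary (a : cochain) : cochain := fun x =>
  let: existT p s := x in
  match p return simplex p -> int with
  | 0 => fun=> 0
  | p'.+1 => fun s => \sum_(j < p'.+2) (-1) ^+ j * value a (face s (lift j))
  end s.

(* The i-th summand evaluates a on the face [0..i] and b on the face [i..p]. *)
Definition cup (a b : cochain) : cochain := fun x =>
  let: existT p s := x in
  \sum_(i < p.+1)
     value a (face s (fun l : 'I_i.+1 => inord l))
     * value b (face s (fun l : 'I_(p - i).+1 => inord (i + l))).

Definition unit_cochain : cochain := fun x => (tag x == 0)%:R.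

Arguments coboundary : simpl never.
Arguments cup : simpl never.

Lemma vertex_mapK p q r (f : 'I_q.+1 -> 'I_p.+1) (g : 'I_r.+1 -> 'I_q.+1) t :
  vertex_map f (vertex_map g t) = vertex_map (f \o g) t.
Proof.
apply/val_inj/rowP => j /=; rewrite !mxE.
under eq_bigr do rewrite mxE.
rewrite (exchange_big_dep (fun i => f (g i) == j)) /=; last first.
  by move=> l i /eqP <- /eqP ->.
apply: eq_bigr => i /eqP fgi; rewrite (big_pred1 (g i)) // => l.
by rewrite /= [g i == l]eq_sym; case: (l =P g i) => [->|]; rewrite ?andbF // fgi eqxx.
Qed.

Definition nface p (s : simplex p) q (g : nat -> nat) : {p : nat & simplex p} :=
  existT _ q (face s (fun l : 'I_q.+1 => inord (g l))).

Lemma nface_ext p (s : simplex p) q g h : (forall l, (l <= q)%N -> g l = h l) ->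
  nface s q g = nface s q h.
Proof.
move=> gh; rewrite /nface; congr existT; congr face.
by apply/funext => l; rewrite gh // -ltnS.
Qed.

Lemma nface_comp p (s : simplex p) q (g : nat -> nat) r (h : nat -> nat) : (forall l, (l <= r)%N -> (h l <= q)%N) ->
  nface (face s (fun l : 'I_q.+1 => inord (g l))) r h = nface s r (g \o h).
Proof.
move=> hq; rewrite /nface; congr existT; apply/continuousEP => t /=.
rewrite vertex_mapK; congr (s (vertex_map _ _)).
by apply/funext => l /=; rewrite inordK // ltnS hq // -ltnS.
Qed.

Lemma nface_id p (s : simplex p) : existT _ p s = nface s p id.
Proof.
rewrite /nface; congr existT; apply/continuousEP => t /=; congr (s _).
apply/val_inj/rowP => j; rewrite mxE (big_pred1 j) // => i.
by rewrite inord_val.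
Qed.

Lemma cupE a b p (s : simplex p) q g :
  cup a b (nface s q g) =
  \sum_(i < q.+1) a (nface s i g) * b (nface s (q - i) (fun l => g (i + l)%N)).
Proof.
apply: eq_bigr => i _; rewrite /value; congr (a _ * b _).
  by rewrite -/(nface _ i id) nface_comp // => l /leq_trans; apply; rewrite -ltnS.
rewrite -/(nface _ (q - i) (fun l => i + l)%N) nface_comp // => l li.
by rewrite -leq_subRL // -ltnS.
Qed.

Lemma coboundaryE a p (s : simplex p) q g :
  coboundary a (nface s q.+1 g) =
  \sum_(j < q.+2) (-1) ^+ j * a (nface s q (fun l => g (bump j l))).
Proof.
apply: eq_bigr => j _; rewrite /value; congr (_ * a _).
transitivity (nface (face s (fun l : 'I_q.+2 => inord (g l))) q (bump j)).
  rewrite /nface; congr existT; congr face; apply/funext => l.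
  by apply/val_inj; rewrite /= inordK //; exact: (ltn_ord (lift j l)).
by rewrite nface_comp // => l lq; exact: (leq_add (leq_b1 _) lq).
Qed.

Lemma coboundary0 a p (s : simplex p) g : coboundary a (nface s 0 g) = 0.
Proof. by []. Qed.

Lemma cochain_ext (a b : cochain) :
  (forall p (s : simplex p), a (nface s p id) = b (nface s p id)) -> a = b.
Proof. by move=> ab; apply/funext => -[p s]; rewrite nface_id. Qed.

Lemma cochainD (a b : cochain) x : (a + b) x = a x + b x. Proof. by []. Qed.

Lemma cochainN (a : cochain) x : (- a) x = - a x. Proof. by []. Qed.

Lemma cupA : associative cup.
Proof.
move=> a b c; apply: cochain_ext => p s; rewrite !cupE.
under eq_bigr do rewrite cupE mulr_sumr.
under [RHS]eq_bigr do rewrite cupE mulr_suml.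
pose F i j := a (nface s j id) * b (nface s (i - j) (fun l => j + l)%N)
  * c (nface s (p - i) (fun l => i + l)%N).
rewrite [RHS](_ : _ = \sum_(0 <= i < p.+1) \sum_(0 <= j < p.+1 | (j <= i)%N) F i j).
  rewrite (exchange_big_dep xpredT) //= big_mkord; apply: eq_bigr => j _.
  rewrite [RHS](_ : _ = \sum_(j <= i < p.+1) F i j).
    have -> (n : nat) : \sum_(n <= i < p.+1) F i n =
        \sum_(0 <= i < p.+1 - n) F (i + n)%N n.
      by rewrite -{1}[n]add0n big_addn.
    rewrite subSn ?big_mkord; last by rewrite -ltnS.
    apply: eq_bigr => l _; rewrite /F addnK mulrA addnC subnDA.
    congr (_ * _ * c _); apply: nface_ext => x _; by rewrite addnA.
  by rewrite [LHS]big_mkord [RHS](big_geq_mkord _ _ xpredT).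
rewrite big_mkord; apply: eq_bigr => i _.
transitivity (\sum_(j < i.+1) F i j) => //.
by rewrite (big_ord_widen p.+1 (F i)) // big_mkord.
Qed.

Lemma cup1l : left_id unit_cochain cup.
Proof.
move=> a; apply: cochain_ext => p s; rewrite cupE big_ord_recl /= big1 ?addr0.
  by rewrite /unit_cochain /= mul1r subn0.
by move=> i _; rewrite /unit_cochain /= mul0r.
Qed.

Lemma cup1r : right_id unit_cochain cup.
Proof.
move=> a; apply: cochain_ext => p s; rewrite cupE big_ord_recr /= big1 ?add0r.
  by rewrite /unit_cochain /= subnn mulr1.
by move=> i _; rewrite /unit_cochain /= subn_eq0 leqNgt ltn_ord mulr0.
Qed.

Lemma cupDl : left_distributive cup +%R.
Proof.
move=> a b c; apply: cochain_ext => p s; rewrite cochainD !cupE -big_split.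
by apply: eq_bigr => i _; rewrite /= cochainD mulrDl.
Qed.

Lemma cupDr : right_distributive cup +%R.
Proof.
move=> a b c; apply: cochain_ext => p s; rewrite cochainD !cupE -big_split.
by apply: eq_bigr => i _; rewrite /= cochainD mulrDr.
Qed.

Lemma coboundaryB : {morph coboundary : a b / a - b}.
Proof.
move=> a b; apply: cochain_ext => -[|p] s.
  by rewrite cochainD cochainN !coboundary0 subr0.
rewrite cochainD cochainN !coboundaryE -sumrB.
by apply: eq_bigr => i _; rewrite cochainD cochainN mulrBr.
Qed.

(* a |-> (-1)^p a in degree p, the sign of the Leibniz rule. *)
Definition alternate (a : cochain) : cochain := fun x => (-1) ^+ tag x * a x.

Lemma coboundary_cup a b :
  coboundary (cup a b) = cup (coboundary a) b + cup (alternate a) (coboundary b).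
Proof.
apply: cochain_ext => -[|p] s.
  by rewrite cochainD !cupE !big_ord1 !coboundary0 mul0r mulr0 addr0.
rewrite cochainD coboundaryE !cupE.
under eq_bigr do rewrite cupE mulr_sumr.
rewrite exchange_big /= [X in _ = X + _]big_ord_recl /= coboundary0 mul0r add0r.
rewrite [X in _ = _ + X]big_ord_recr /= subnn coboundary0 mulr0 addr0 -big_split /=.
apply: eq_bigr => i _; have ip : (i <= p)%N by rewrite -ltnS.
rewrite -[bump 0 i]/i.+1 subSS subSn // !coboundaryE mulr_suml mulr_sumr.
pose u j := a (nface s i (bump j)).
pose w j := b (nface s (p - i) (fun l => bump j (i + l)))%N.
have ui j : (i < j)%N -> u j = a (nface s i id).
  move=> ij; congr a; apply: nface_ext => l li.
  by rewrite /bump leqNgt (leq_ltn_trans li ij).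
have wi j : (j <= i)%N -> w j = b (nface s (p - i) (fun l => i.+1 + l)%N).
  move=> ji; congr b; apply: nface_ext => l _.
  by rewrite /bump (leq_trans ji (leq_addr _ _)).
have wD j : b (nface s (p - i) (fun l => i + bump j l)%N) = w (i + j)%N.
  by congr b; apply: nface_ext => l _; rewrite /bump leq_add2l addnCA.
transitivity (\sum_(0 <= j < p.+2) (-1) ^+ j * (u j * w j)); first by rewrite big_mkord.
rewrite (@big_cat_nat _ _ _ i.+1) //=; last by rewrite ltnS ltnW.
rewrite big_ord_recr [X in _ = _ + X]big_ord_recl /=.
have -> : alternate a (nface s i id) = (-1) ^+ i * a (nface s i id) by [].
rewrite -[a (nface s i (fun l => bump i.+1 l))]/(u i.+1) ui // -(wi i) //.
rewrite wD addn0 expr0 mul1r exprS mulN1r !mulNr addrA subrK.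
congr (_ + _).
  by rewrite big_mkord; apply: eq_bigr => j _; rewrite mulrA (wi i) // (wi j) // -ltnS.
rewrite -{1}[i.+1]add0n big_addn big_mkord subSS subSn //.
apply: eq_bigr => j _.
rewrite -[bump 0 j]/j.+1 wD ui ?addnS ?ltnS ?leq_addl // [in LHS]addnC.
by rewrite -addnS exprD -!mulrA; congr (_ * _); rewrite mulrCA.
Qed.

HB.instance Definition _ :=
  GRing.Zmodule_isPzRing.Build cochain cupA cup1l cup1r cupDl cupDr.

Lemma cochainM (a b : cochain) : a * b = cup a b. Proof. by []. Qed.

Lemma coboundary1 : coboundary 1 = 0.
Proof.
apply: cochain_ext => -[|p] s; first by rewrite coboundary0.
rewrite coboundaryE; case: p s => [|p] s.
  by rewrite big_ord_recl big_ord1 /= mul1r mulN1r subrr.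
by rewrite big1 // => j _; rewrite mulr0.
Qed.

Lemma coboundary_alternate a : coboundary a = 0 -> coboundary (alternate a) = 0.
Proof.
move=> da; apply: cochain_ext => -[|p] s; first by rewrite coboundary0.
have := congr1 (fun c : cochain => c (nface s p.+1 id)) da.
rewrite !coboundaryE => /(congr1 (fun x => (-1) ^+ p * x)).
rewrite [X in _ = X -> _]mulr0 mulr_sumr => E.
apply: etrans E; apply: eq_bigr => j _.
by rewrite /alternate /= mulrCA.
Qed.

Lemma alternateK : involutive alternate.
Proof. by move=> a; apply/funext => x; rewrite /alternate mulrA -expr2 sqrr_sign mul1r. Qed.

(* Vanishing in large degrees makes the quotient below the direct sum, and not
   the product, of the H^p. *)
Definition cocycle : {pred cochain} := fun a =>
  `[< (exists d, forall x, (d < tag x)%N -> a x = 0) /\ coboundary a = 0 >].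

Lemma cocycle_subring : subring_closed cocycle.
Proof.
split.
- apply/asboolP; split; last exact: coboundary1.
  by exists 0%N => -[[|p] s].
- move=> a b /asboolP[[d ad] da] /asboolP[[e be] db]; apply/asboolP; split.
    exists (maxn d e) => x; rewrite gtn_max => /andP[dx ex].
    by rewrite cochainD cochainN ad // be // subr0.
  by rewrite coboundaryB da db subr0.
- move=> a b /asboolP[[d ad] da] /asboolP[[e be] db]; apply/asboolP; split.
    exists (d + e)%N => -[p s] /= dep; rewrite nface_id cochainM cupE big1 // => i _.
    have [di|id] := ltnP d i; first by rewrite ad ?mul0r.
    rewrite be ?mulr0 //= ltn_subRL addnC.
    by apply: leq_ltn_trans dep; rewrite addnC leq_add2r.
  by rewrite coboundary_cup da db -!cochainM mul0r mulr0 addr0.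
Qed.

HB.instance Definition _ :=
  GRing.isSubringClosed.Build cochain cocycle cocycle_subring.

Record cocycle_type :=
  Cocycle { cocycle_val :> cochain; cocycle_valP : cocycle_val \in cocycle }.
HB.instance Definition _ := [isSub for cocycle_val].
HB.instance Definition _ := [Choice of cocycle_type by <:].
HB.instance Definition _ := GRing.SubChoice_isSubPzRing.Build
  cochain cocycle cocycle_type (subringClosedP _).

Lemma cocycleE (a : cocycle_type) : coboundary a = 0.
Proof. by have /asboolP[] := cocycle_valP a. Qed.

Definition coboundaries : {pred cocycle_type} := fun a =>
  `[< exists b, coboundary b = val a >].

Lemma coboundaries_zmod : zmod_closed coboundaries.
Proof.
split; first by apply/asboolP; exists (0 - 0); rewrite coboundaryB subrr raddf0.
move=> a b /asboolP[c cE] /asboolP[d dE]; apply/asboolP; exists (c - d).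
by rewrite coboundaryB cE dE raddfB.
Qed.
HB.instance Definition _ :=
  GRing.isZmodClosed.Build cocycle_type coboundaries coboundaries_zmod.

Lemma coboundariesMr a b : a \in coboundaries -> a * b \in coboundaries.
Proof.
move=> /asboolP[c cE]; apply/asboolP; exists (cup c (val b)).
by rewrite coboundary_cup cE cocycleE rmorphM -!cochainM mulr0 addr0.
Qed.

Lemma coboundariesMl a b : b \in coboundaries -> a * b \in coboundaries.
Proof.
move=> /asboolP[c cE]; apply/asboolP; exists (cup (alternate (val a)) c).
rewrite coboundary_cup alternateK cE coboundary_alternate ?cocycleE // rmorphM.
by rewrite -!cochainM mul0r add0r.
Qed.

Definition cohomology := Quotient.quot coboundaries.
HB.instance Definition _ := GRing.Zmodule.on cohomology.
HB.instance Definition _ := EqQuotient.on cohomology.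

Definition cohomology_one : cohomology := \pi 1.
Definition cohomology_mul : cohomology -> cohomology -> cohomology :=
  lift_op2 cohomology *%R.

Lemma pi_cohomology_mul :
  {morph \pi_cohomology : a b / a * b >-> cohomology_mul a b}.
Proof.
move=> a b; rewrite /cohomology_mul; unlock; apply/eqP; rewrite piE Quotient.equivE.
rewrite -[a * b](subrK (repr (\pi_cohomology a) * b)) -mulrBl -addrA -mulrBr.
by apply: rpredD; [apply: coboundariesMr|apply: coboundariesMl];
  rewrite Quotient.idealrBE reprK.
Qed.

Let piM := pi_cohomology_mul.
Let piD := Quotient.pi_add coboundaries.

Lemma cohomology_mulA : associative cohomology_mul.
Proof.
by elim/quotW => a; elim/quotW => b; elim/quotW => c; rewrite -!piM mulrA.
Qed.

Lemma cohomology_mul1 : left_id cohomology_one cohomology_mul.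
Proof. by elim/quotW => a; rewrite -piM mul1r. Qed.

Lemma cohomology_1mul : right_id cohomology_one cohomology_mul.
Proof. by elim/quotW => a; rewrite -piM mulr1. Qed.

Lemma cohomology_mulDl : left_distributive cohomology_mul +%R.
Proof.
elim/quotW => a; elim/quotW => b; elim/quotW => c.
by rewrite -[LHS]/(cohomology_mul (Quotient.add _ _) _) -piD -!piM mulrDl piD.
Qed.

Lemma cohomology_mulDr : right_distributive cohomology_mul +%R.
Proof.
elim/quotW => a; elim/quotW => b; elim/quotW => c.
by rewrite -[LHS]/(cohomology_mul _ (Quotient.add _ _)) -piD -!piM mulrDr piD.
Qed.

HB.instance Definition _ := GRing.Zmodule_isPzRing.Build cohomology
  cohomology_mulA cohomology_mul1 cohomology_1mul
  cohomology_mulDl cohomology_mulDr.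

End Singular.

Arguments std_simplex : clear implicits.

Section Partitions.
Variables k m : nat.

(* Partitions (lam_1 >= ... >= lam_k) with lam_1 <= m; indices start at 0, so
   that lam_i is [lam (i - 1)]. *)
Record rect_part := RectPart {
  parts :> {ffun 'I_k -> 'I_m.+1};
  _ : [forall i : 'I_k, forall j : 'I_k, (i <= j)%N ==> (parts j <= parts i)%N] }.
HB.instance Definition _ := [isSub for parts].
HB.instance Definition _ := [Finite of rect_part by <:].

Definition weight (lam : rect_part) : nat := \sum_i lam i.

Lemma dual_part_subproof (lam : rect_part) :
  let d := [ffun i => rev_ord (lam (rev_ord i))] in
  [forall i : 'I_k, forall j : 'I_k, (i <= j)%N ==> (d j <= d i)%N].
Proof.
case: lam => lam /= /'forall_'forall_implyP lamP.
apply/'forall_'forall_implyP => i j ij; rewrite !ffunE /= !subSS leq_sub2l //.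
by apply: lamP; rewrite /= leq_sub2l.
Qed.

Definition dual_part (lam : rect_part) : rect_part :=
  RectPart (dual_part_subproof lam).

Lemma row_part_subproof (p : 'I_m.+1) :
  let d : {ffun 'I_k -> _} := [ffun i => if val i == 0%N then p else ord0] in
  [forall i : 'I_k, forall j : 'I_k, (i <= j)%N ==> (d j <= d i)%N].
Proof.
apply/'forall_'forall_implyP => i j; rewrite !ffunE.
by case: (val j =P 0%N) => [/= ->|//]; rewrite leqn0 => ->.
Qed.

Definition row_part (p : 'I_m.+1) : rect_part := RectPart (row_part_subproof p).

Definition part_le (mu lam : rect_part) : bool := [forall i, (mu i <= lam i)%N].

(* The box of row r and column c belongs to lam/mu. *)
Definition in_skew (lam mu : rect_part) (r : 'I_k) (c : 'I_m) : bool :=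
  (mu r <= c < lam r)%N.

(* lam/mu is a horizontal strip with p boxes. *)
Definition horizontal_strip (lam mu : rect_part) (p : nat) : bool :=
  [&& part_le mu lam,
      #|[pred b : 'I_k * 'I_m | in_skew lam mu b.1 b.2]| == p
    & [forall r, forall r', forall c,
         in_skew lam mu r c && in_skew lam mu r' c ==> (r == r')]].

(* Fillings of skew shapes by positive integers, recorded on the whole k x m
   rectangle with the value 0 exactly outside the shape.  Entries are bounded
   by k: a tableau whose content is a partition with at most k parts has no
   larger entry, so the count in [LR_number] is unaffected. *)
Definition filling := {ffun 'I_k * 'I_m -> 'I_k.+1}.

Definition is_tableau (lam mu : rect_part) (t : filling) : Prop :=
  [/\ forall r c, (0 < t (r, c))%N = in_skew lam mu r c,
      forall r c c', in_skew lam mu r c -> in_skew lam mu r c' -> (c <= c')%N ->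
        (t (r, c) <= t (r, c'))%N
    & forall r r' c, in_skew lam mu r c -> in_skew lam mu r' c -> (r < r')%N ->
        (t (r, c) < t (r', c))%N].

Definition content (lam mu : rect_part) (t : filling) (i : nat) : nat :=
  #|[pred b | in_skew lam mu b.1 b.2 & t b == i :> nat]|.

Definition word (lam mu : rect_part) (t : filling) : seq nat :=
  flatten [seq [seq val (t (r, c)) | c <- rev (enum 'I_m) & in_skew lam mu r c]
          | r <- enum 'I_k].

Definition lattice_word (w : seq nat) : Prop :=
  forall i j, (1 <= i)%N -> (1 <= j <= size w)%N ->
    (count_mem i.+1 (take j w) <= count_mem i (take j w))%N.

(* c(lam, mu; nu): Littlewood-Richardson tableaux of shape lam^v/mu and content
   nu^v, where ^v is [dual_part]. *)
Definition LR_number (lam mu nu : rect_part) : nat :=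
  if part_le mu (dual_part lam) then
    #|[pred t : filling | `[< [/\ is_tableau (dual_part lam) mu t,
         lattice_word (word (dual_part lam) mu t)
       & forall i : 'I_k, content (dual_part lam) mu t i.+1 = dual_part nu i] >] ]|
  else 0%N.

End Partitions.

Section Grassmannian.
Variables (R : realType) (k n : nat).

Local Notation C := (R[i] : numFieldType).
Local Notation m := (n - k)%N.

Definition row_span (A : 'M[C]_(k, n)) : {vspace 'rV[C]_n} :=
  <<[seq row i A | i : 'I_k]>>%VS.

Record grassmannian := Grassmannian {
  space :> {vspace 'rV[C]_n};
  _ : \dim space == k }.
HB.instance Definition _ := [isSub for space].
HB.instance Definition _ := [Choice of grassmannian by <:].

(* k-tuples of linearly independent vectors of C^n. *)
Definition frame := set_type [set A : 'M[C]_(k, n) | \dim (row_span A) == k].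

Definition frame_span (A : frame) : grassmannian :=
  Grassmannian (set_mem (valP A)).

(* The Grassmannian carries the quotient topology of the space of frames. *)
Definition grassmannian_open (U : set grassmannian) : Prop :=
  open (frame_span @^-1` U : set frame).

Lemma grassmannian_openT : grassmannian_open setT.
Proof. exact: openT. Qed.

Lemma grassmannian_openI U V :
  grassmannian_open U -> grassmannian_open V -> grassmannian_open (U `&` V).
Proof. exact: openI. Qed.

Lemma grassmannian_open_bigU (I : Type) (f : I -> set grassmannian) :
  (forall i, grassmannian_open (f i)) -> grassmannian_open (\bigcup_i f i).
Proof. by move=> fO; apply: bigcup_open => i _; exact: fO. Qed.

HB.instance Definition _ := isOpenTopological.Build grassmannian
  grassmannian_openT grassmannian_openI grassmannian_open_bigU.

(* F_j is spanned by the first j rows of E; every complete flag of C^n is of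
   this form for some invertible E. *)
Definition flag (E : 'M[C]_n) (j : nat) : {vspace 'rV[C]_n} :=
  <<[seq row l E | l : 'I_n <- enum 'I_n & (l < j)%N]>>%VS.

Definition schubert_variety (E : 'M[C]_n) (lam : rect_part k m) :
    set grassmannian :=
  [set V | forall i : 'I_k,
     (i.+1 <= \dim (space V :&: flag E (m + i.+1 - lam i)))%N].

(* The Schubert class is defined as the image in H^(2|lam|)(X) of the class in
   H^(2|lam|)(X, X \ Omega) that is dual to the irreducible subvariety
   Omega = schubert_variety E lam of complex codimension |lam|.  The relative
   group is infinite cyclic and the dual class is the generator taking the value
   1 on a small positively oriented disc transverse to Omega at a smooth point.

   At the coordinate subspace spanned by the rows [pivot lam i] of E, such a
   disc is found in the affine space of the row spans of the matrices
     row i = E_(pivot i) + sum over l of z_(i,l) E_l,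
   l ranging over the non-pivots beyond [pivot i].  There are |lam| parameters
   z_(i,l), and this affine space meets Omega only at z = 0, transversally.  The
   disc is the simplex t |-> z(t) below: with C^|lam| = R^(2|lam|) oriented by
   (Re z_0, Im z_0, Re z_1, ...), its vertices are (-1,...,-1) and the vectors of
   the standard basis, so that it is affine, positively oriented and contains 0
   in its interior. *)
Definition pivot (lam : rect_part k m) (i : 'I_k) : nat := (m + i - lam i)%N.

Definition slice_entries (lam : rect_part k m) : seq ('I_k * 'I_n) :=
  [seq e : 'I_k * 'I_n <- enum {: 'I_k * 'I_n} |
     (pivot lam e.1 < e.2)%N && [forall i, pivot lam i != e.2]].

Definition slice_coord (lam : rect_part k m)
    (t : std_simplex R (weight lam).*2) (q : nat) : R[i] :=
  let u j := val t 0 (inord j) - val t 0 ord0 in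
  (u q.*2.+1 +i* u q.*2.+2)%C.

Definition slice_mx (lam : rect_part k m) (t : std_simplex R (weight lam).*2) :
    'M[C]_(k, n) :=
  \matrix_(i, l) if pivot lam i == l then 1
    else if (i, l) \in slice_entries lam then
      slice_coord t (index (i, l) (slice_entries lam))
    else 0.

(* x is the Schubert class of lam: it has a cocycle representative of degree
   2|lam|, vanishing on the simplices that avoid Omega (a relative cocycle), and
   taking the value 1 on the transverse simplex described above. *)
Definition schubert_class (E : 'M[C]_n) (lam : rect_part k m)
    (x : cohomology R grassmannian) : Prop :=
  exists a : cocycle_type R grassmannian,
  [/\ x = \pi a,
      forall p (s : simplex R grassmannian p),
        p != (weight lam).*2 -> value a s = 0,
      forall p (s : simplex R grassmannian p),
        (forall t, ~ schubert_variety E lam (s t)) -> value a s = 0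
    & exists2 s : simplex R grassmannian (weight lam).*2,
        forall t, space (s t) = row_span (slice_mx t *m E)
      & value a s = 1].

End Grassmannian.

(* Main.v *)
Require Import Defs.
From HB Require Import structures.
From mathcomp Require Import all_boot all_order all_algebra.
From mathcomp Require Import complex.
From mathcomp Require Import boolp classical_sets functions reals topology normedtype.
From mathcomp Require Import fingroup perm zify.

Set Implicit Arguments.
Unset Strict Implicit.
Unset Printing Implicit Defensive.

Import Order.TTheory GRing.Theory Num.Theory.
Import numFieldNormedType.Exports.

(** The argument takes place in any ring with a [Z]-basis [sigma] indexed by the
    partitions in a rectangle, in which multiplication by the classes of one-row
    partitions obeys the Pieri rule.

    Write [h_p] for the class of a row of length [p], with [h_p = 0] for
    [p > m].  Applying the factors of [h_(a_0) ... h_(a_(k-1))] to [sigma mu]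
    one at a time gives a sum over chains [mu = N_0, N_1, ..., N_k] of
    partitions, each obtained from the previous one by adding a horizontal
    strip, the [i]-th strip having [a_i] boxes.  Such chains are the
    semistandard tableaux of shape [N_k/mu]: the boxes with entry [i + 1] are
    those of [N_(i+1)/N_i].  Consequently the Giambelli determinant
    [det (h_(lam_i + j - i))] sends [sigma mu] to a sum over chains signed by
    permutations.  A sign-reversing involution cancels every chain that is not
    Littlewood-Richardson ([signed_count]).  It takes the first failure of the
    lattice condition, in row [r] between the letters [i + 1] and [i + 2], and
    modifies the single partition [N_(i+1)] by a Bender-Knuth reflection of its
    rows from [r] on ([toggle]); the permutation is composed with the
    transposition of [i] and [i + 1].

    Starting from the empty partition, the only Littlewood-Richardson chain of
    content [lam] ends at [lam] ([card_LR_chains_empty]).  So the determinant of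
    [lam] is [sigma lam] ([giambelliE]), and the signed count computes all
    products: the coefficient of [sigma nu] in [sigma lam * sigma mu] is the
    number of Littlewood-Richardson tableaux of shape [nu/mu] and content [lam].

    What remains is to trade this for shape [lam^v/mu] and content [nu^v].
    Rotating a horizontal strip by a half-turn inside the rectangle shows that
    multiplication by [h_p] is self-adjoint for the pairing in which the basis
    dual to [sigma] is [sigma] at the complementary partitions.  The [h_p]
    commute, so multiplication by any [sigma lam] is self-adjoint as well, which
    together with commutativity yields the required symmetry ([coef_mul_dual]).
    Finally [LR_numberE] identifies chains with fillings and the inequality
    satisfied by each pair of consecutive letters, row by row, with the lattice
    property of the reading word. *)

(** * Reflecting the middle partition of two consecutive horizontal strips *)

Definition psum (f : nat -> nat) (n : nat) : nat := \sum_(x < n) f x.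

Lemma psum0 f : psum f 0 = 0%N.
Proof. by rewrite /psum big_ord0. Qed.

Lemma psumS f n : psum f n.+1 = (psum f n + f n)%N.
Proof. by rewrite /psum big_ord_recr. Qed.

Lemma eq_psum f g n : (forall x, (x < n)%N -> f x = g x) -> psum f n = psum g n.
Proof. by move=> fg; apply: eq_bigr => i _; apply: fg. Qed.

(** For row lengths, this says that [g/f] is a horizontal strip. *)
Definition interlace (f g : nat -> nat) : Prop :=
  forall x, (f x <= g x)%N /\ (g x.+1 <= f x)%N.

(** Let [om/tau] carry the letter [i + 1] and [tau/kap] the letter [i].  After
    moving the negative terms across, the inequality says that rows [0..r]
    contain more letters [i + 1] than rows [0..r-1] contain letters [i].  By
    semistandardness that is how the lattice condition fails in row [r]. *)
Definition overflow (kap tau om : nat -> nat) (r : nat) : bool :=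
  (psum tau r.+1 + psum tau r < psum om r.+1 + psum kap r)%N.

(** Below row [r] this is the Bender-Knuth involution: [tau x] is reflected in
    the interval [max (kap x, om (x+1)) .. min (kap (x-1), om x)] of values
    compatible with [kap] and [om].  In row [r] the upper end of the interval is
    lowered to [om r - d - 1], where [d] is the excess of letters [i] over
    letters [i + 1] in the rows above: these are exactly the values for which
    the overflow in row [r] persists.  Written with prefix sums,
    [om r - d = psum om r.+1 + psum kap r - 2 * psum tau r]. *)
Definition toggle (kap om tau : nat -> nat) (r x : nat) : nat :=
  if (x < r)%N then tau x
  else if x == r then
    (psum om r.+1 + psum kap r + maxn (kap r) (om r.+1)
     - (psum tau r.+1 + psum tau r).+1)%N
  else (minn (kap x.-1) (om x) + maxn (kap x) (om x.+1) - tau x)%N.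

Section Toggle.
Variables (kap tau om : nat -> nat) (r : nat).
Hypothesis kap_tau : interlace kap tau.
Hypothesis tau_om : interlace tau om.

Let tau' := toggle kap om tau r.

Lemma toggle_psum_le n : (n <= r)%N -> psum tau' n = psum tau n.
Proof.
move=> nr; apply: eq_psum => x xn.
by rewrite /tau' /toggle (leq_trans xn nr).
Qed.

Lemma toggle_gt x : (r < x)%N ->
  (tau' x + tau x = minn (kap x.-1) (om x) + maxn (kap x) (om x.+1))%N.
Proof.
case: x => // x rx; rewrite /tau' /toggle ltnNge (ltnW rx) /= eqn_leq leqNgt rx /=.
have := kap_tau x.+1; have := tau_om x.+1; have := kap_tau x; have := tau_om x.
lia.
Qed.

Lemma toggle_below x : (x < r)%N -> tau' x = tau x.
Proof. by rewrite /tau' /toggle => ->. Qed.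

Lemma psum_interlace n : (psum kap n <= psum tau n)%N.
Proof. by apply: leq_sum => i _; case: (kap_tau i). Qed.

Hypothesis over_r : overflow kap tau om r.

Lemma toggle_at :
  (tau' r + (psum tau r.+1 + psum tau r).+1 =
   psum om r.+1 + psum kap r + maxn (kap r) (om r.+1))%N.
Proof.
move: over_r; rewrite /overflow /tau' /toggle ltnn eqxx.
have := kap_tau r; have := tau_om r; lia.
Qed.

(** From row [r] on the two ends of the reflection intervals telescope, as
    [min (a, b) + max (a, b) = a + b]; only the last [max] survives. *)
Lemma toggle_psum_gt n : (r <= n)%N ->
  (psum tau' n.+1 + (psum tau n.+1).+1 =
   psum kap n + psum om n.+1 + maxn (kap n) (om n.+1))%N.
Proof.
elim: n => [|n IHn].
  rewrite leqn0 => /eqP r0; have := toggle_at.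
  by rewrite r0 !psumS !psum0; lia.
rewrite leq_eqVlt => /orP[/eqP rn|]; last first.
  rewrite ltnS => rn; have := IHn rn; rewrite !(psumS _ n.+1) (psumS kap n).
  by have := @toggle_gt n.+1 rn; rewrite /=; lia.
rewrite -rn (psumS tau') toggle_psum_le //.
by have := toggle_at; rewrite !psumS; lia.
Qed.

(** The sizes of the two strips are exchanged up to a shift by one: the new
    lower strip is one box smaller than the old upper strip.  This matches the
    action of a transposition on the exponents of a determinant. *)
Lemma toggle_size K : (r < K)%N -> om K = 0%N ->
  (psum tau' K + (psum tau K).+1 = psum kap K + psum om K)%N.
Proof.
case: K => // K; rewrite ltnS => rK omK; have := toggle_psum_gt rK.
by rewrite (psumS kap) omK; lia.
Qed.

Lemma toggle_overflow x : (x <= r)%N ->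
  overflow kap tau' om x = overflow kap tau om x.
Proof.
rewrite leq_eqVlt => /orP[/eqP->|xr]; last first.
  by rewrite /overflow !toggle_psum_le // ltnW.
rewrite over_r /overflow (psumS tau') toggle_psum_le //.
have := toggle_at; have := kap_tau r; have := tau_om r; rewrite !psumS; lia.
Qed.

Hypothesis under_r : forall x, (x < r)%N -> ~~ overflow kap tau om x.

(** The delicate bound is [tau' r <= kap r.-1].  Without overflow in row
    [r.-1], the excess [d] is at least [tau r.-1 - kap r.-1], hence
    [om r - d <= tau r.-1 - d <= kap r.-1]. *)
Lemma toggle_bounds x :
  [/\ (kap x <= tau' x)%N, (tau' x <= om x)%N, (om x.+1 <= tau' x)%N
    & (0 < x)%N -> (tau' x <= kap x.-1)%N].
Proof.
have [xr|xr|->] := ltngtP x r.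
- rewrite toggle_below //.
  have := kap_tau x; have := tau_om x; have := kap_tau x.-1.
  by case: x xr => [|x] xr /=; split; lia.
- have := toggle_gt xr; have := kap_tau x; have := tau_om x.
  have := kap_tau x.-1; have := tau_om x.-1.
  by case: x xr => [|x] xr //=; split; lia.
have := toggle_at; have := over_r; rewrite /overflow !psumS.
have := kap_tau r; have := tau_om r.
have := kap_tau r.-1; have := tau_om r.-1.
have Er : (0 < r)%N -> (psum om r + psum kap r.-1 <= psum tau r + psum tau r.-1)%N.
  case: r under_r => [|r'] // ur _; have := ur r' (ltnSn _).
  by rewrite /overflow -leqNgt.
move: Er; case: r => [|r'] /=; rewrite ?psum0; first by move=> *; split; lia.
move=> /(_ isT); rewrite !psumS.
have := psum_interlace r'.
by move=> *; split; lia.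
Qed.

Lemma toggle_interlace_low : interlace kap tau'.
Proof.
by move=> x; case: (toggle_bounds x) => ? ? ? ?; case: (toggle_bounds x.+1) => ? ? ? /(_ isT).
Qed.

Lemma toggle_interlace_up : interlace tau' om.
Proof. by move=> x; case: (toggle_bounds x). Qed.

End Toggle.

Lemma toggleK kap tau om r : interlace kap tau -> interlace tau om ->
  overflow kap tau om r -> (forall x, (x < r)%N -> ~~ overflow kap tau om x) ->
  forall x, toggle kap om (toggle kap om tau r) r x = tau x.
Proof.
move=> kt to ov un x.
have il := toggle_interlace_low kt to ov un; have iu := toggle_interlace_up kt to ov un.
have ov' : overflow kap (toggle kap om tau r) om r by rewrite toggle_overflow.
have [xr|xr|->] := ltngtP x r.
- by rewrite !toggle_below.
- have := toggle_gt il iu xr; have := toggle_gt kt to xr; lia.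
have := toggle_at il iu ov'; have := toggle_at kt to ov.
rewrite !psumS toggle_psum_le //; lia.
Qed.

(** * Row lengths, horizontal strips and complements *)

Section Rows.
Variables k m : nat.
Implicit Types lam mu nu : rect_part k m.

(** Extending the row lengths by zero makes the interlacing inequalities
    uniform, with no special case for the last row. *)
Definition row_len lam (x : nat) : nat :=
  if insub x is Some i then lam i else 0%N.

Lemma row_len_ord lam (i : 'I_k) : row_len lam i = lam i.
Proof. by rewrite /row_len valK. Qed.

Lemma row_len_out lam x : (k <= x)%N -> row_len lam x = 0%N.
Proof. by move=> kx; rewrite /row_len insubF // ltnNge kx. Qed.

Lemma row_len_anti lam x y : (x <= y)%N -> (row_len lam y <= row_len lam x)%N.
Proof.
move=> xy; have [yk|ky] := ltnP y k; last by rewrite row_len_out.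
have xk := leq_ltn_trans xy yk.
rewrite -[x]/(val (Ordinal xk)) -[y]/(val (Ordinal yk)) !row_len_ord.
by case: lam => lam /= /'forall_'forall_implyP; apply.
Qed.

Lemma row_len_max lam x : (row_len lam x <= m)%N.
Proof. by rewrite /row_len; case: insub => // i; rewrite -ltnS. Qed.

Lemma row_len_inj lam mu : (forall x, row_len lam x = row_len mu x) -> lam = mu.
Proof.
move=> e; apply/val_inj/ffunP => i; apply/val_inj.
by have := e i; rewrite !row_len_ord.
Qed.

Lemma weightE lam : weight lam = psum (row_len lam) k.
Proof. by apply: eq_bigr => i _; rewrite row_len_ord. Qed.

Definition empty_part : rect_part k m := row_part k ord0.

Lemma row_part_row (p : 'I_m.+1) x :
  row_len (row_part k p) x = if (x == 0%N) && (0 < k)%N then p : nat else 0%N.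
Proof.
have [xk|kx] := ltnP x k; last first.
  by rewrite row_len_out //; case: x kx => //; rewrite leqn0 => /eqP ->.
rewrite (leq_ltn_trans _ xk) // andbT -[x]/(val (Ordinal xk)) row_len_ord ffunE /=.
by case: eqP.
Qed.

Lemma row_empty x : row_len empty_part x = 0%N.
Proof. by rewrite row_part_row; case: ifP. Qed.

Definition part_of (f : nat -> nat) : rect_part k m :=
  insubd empty_part [ffun i : 'I_k => inord (f i)].

Lemma row_part_of (f : nat -> nat) :
  (forall x, f x.+1 <= f x)%N -> (f 0 <= m)%N -> (forall x, k <= x -> f x = 0)%N ->
  forall x, row_len (part_of f) x = f x.
Proof.
move=> fS f0 fk x.
have fanti y z : (y <= z)%N -> (f z <= f y)%N.
  by move=> /subnK <-; elim: (z - y)%N => // d; exact: leq_trans (fS _).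
have [xk|kx] := ltnP x k; last by rewrite row_len_out ?fk.
have dE (i : 'I_k) : inord (n' := m) (f i) = f i :> nat.
  by rewrite inordK // ltnS (leq_trans _ f0) // fanti.
rewrite -[x]/(val (Ordinal xk)) row_len_ord insubdK; first by rewrite ffunE dE.
by rewrite unfold_in /=; apply/'forall_'forall_implyP => i j ij; rewrite !ffunE !dE fanti.
Qed.

Definition hstrip mu lam : bool :=
  [forall x : 'I_k, (row_len mu x <= row_len lam x)%N
                 && (row_len lam x.+1 <= row_len mu x)%N].

Lemma hstripP mu lam : reflect (interlace (row_len mu) (row_len lam)) (hstrip mu lam).
Proof.
apply: (iffP forallP) => [H x|H x]; last by apply/andP.
have [xk|kx] := ltnP x k; first by have /andP := H (Ordinal xk).
by rewrite !row_len_out // leqW.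
Qed.

Lemma hstrip_weight mu lam : hstrip mu lam -> (weight mu <= weight lam)%N.
Proof.
by move=> /hstripP H; rewrite !weightE; apply: leq_sum => i _; case: (H i).
Qed.

Lemma card_skew_row (a b : nat) : (b <= m)%N ->
  #|[pred c : 'I_m | (a <= c < b)%N]| = (b - a)%N.
Proof.
move=> bm; rewrite -sum1_card /= -[RHS]muln1 -sum_nat_const_nat big_geq_mkord.
by rewrite (big_ord_widen_cond m (fun i => (a <= i)%N) (fun=> 1%N)).
Qed.

Lemma card_skew lam mu : part_le mu lam ->
  (#|[pred b : 'I_k * 'I_m | in_skew lam mu b.1 b.2]| + weight mu)%N = weight lam.
Proof.
move=> /forallP le; rewrite -sum1_card /=.
rewrite (eq_bigl (fun b : 'I_k * 'I_m => true && in_skew lam mu b.1 b.2)) //.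
rewrite -(pair_big_dep xpredT (fun r c => in_skew lam mu r c) (fun _ _ => 1%N)) /=.
rewrite /weight -big_split /=; apply: eq_bigr => r _.
by rewrite sum1_card card_skew_row ?subnK // -ltnS.
Qed.

(** No two boxes share a column exactly when each row ends no later than the
    previous row of the smaller partition. *)
Lemma horizontal_stripE lam mu p :
  horizontal_strip lam mu p = hstrip mu lam && (weight lam == weight mu + p)%N.
Proof.
apply/and3P/andP => [[le /eqP cp /'forall_'forall_'forall_implyP np]|[H /eqP wE]].
  split; last by rewrite -(card_skew le) cp addnC.
  apply/forallP => r; rewrite !row_len_ord; apply/andP; split; first exact: (forallP le).
  have [rk|kr] := ltnP r.+1 k; last by rewrite row_len_out.
  rewrite -[r.+1]/(val (Ordinal rk)) row_len_ord leqNgt; apply/negP => lt.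
  have cm : (mu r < m)%N by rewrite (leq_trans lt) // -ltnS.
  (* Otherwise column [mu r] meets the strip in both rows [r] and [r + 1]. *)
  have := np r (Ordinal rk) (Ordinal cm); rewrite /in_skew /= leqnn lt andbT.
  rewrite (leq_trans lt) /=; last by rewrite -!row_len_ord row_len_anti.
  have -> : (mu (Ordinal rk) <= mu r)%N by rewrite -!row_len_ord row_len_anti /=.
  by move=> /(_ isT) /eqP/(congr1 val) /= /eqP; rewrite eqn_leq ltnn andbF.
have le : part_le mu lam.
  by apply/forallP => r; rewrite -!row_len_ord; case/hstripP/(_ r): H.
split=> //; first by rewrite -(eqn_add2r (weight mu)) card_skew // wE addnC.
have key (r r' : 'I_k) (c : 'I_m) :
    in_skew lam mu r c -> in_skew lam mu r' c -> ~~ (r < r')%N.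
  rewrite /in_skew -!row_len_ord => /andP[ac _] /andP[_ cb]; apply/negP => rr.
  have [_ H2] := (hstripP _ _ H) r; have := row_len_anti lam rr.
  by lia.
apply/'forall_'forall_'forall_implyP => r r' c /andP[a b].
have := key _ _ _ a b; have := key _ _ _ b a; rewrite -!leqNgt => le1 le2.
by apply/eqP/val_inj/eqP; rewrite eqn_leq le1 le2.
Qed.

Lemma row_dual lam x : (x < k)%N ->
  row_len (dual_part lam) x = (m - row_len lam (k.-1 - x))%N.
Proof.
move=> xk; rewrite -[x in LHS]/(val (Ordinal xk)) row_len_ord ffunE /= subSS.
have -> : (k.-1 - x)%N = val (rev_ord (Ordinal xk)) by rewrite /=; lia.
by rewrite row_len_ord.
Qed.

Lemma dual_partK : involutive (@dual_part k m).
Proof.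
move=> lam; apply: row_len_inj => x.
have [xk|kx] := ltnP x k; last by rewrite !row_len_out.
rewrite row_dual // row_dual; last by lia.
rewrite subKn ?row_len_max //; congr row_len; lia.
Qed.

Lemma weight_dual lam : (weight (dual_part lam) + weight lam = k * m)%N.
Proof.
rewrite /weight [X in (_ + X)%N](reindex_inj rev_ord_inj) -big_split /=.
rewrite -[k in RHS]card_ord -sum_nat_const; apply: eq_bigr => i _.
by rewrite ffunE /= subSS subnK // -ltnS.
Qed.

Lemma hstrip_dual lam mu : hstrip (dual_part lam) (dual_part mu) = hstrip mu lam.
Proof.
suff imp a b : hstrip a b -> hstrip (dual_part b) (dual_part a).
  by apply/idP/idP; last exact: imp; move/imp; rewrite !dual_partK.
move=> /hstripP H; apply/forallP => x; have xk := ltn_ord x.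
have [H1 _] := H (k.-1 - x)%N; rewrite !(row_dual _ xk).
apply/andP; split; first lia.
have [xk1|kx1] := ltnP x.+1 k; last by rewrite row_len_out.
rewrite row_dual //; have [_ H2] := H (k.-1 - x.+1)%N.
have E : (k.-1 - x.+1).+1 = (k.-1 - x)%N by lia.
by rewrite E in H2; lia.
Qed.

(** A half-turn of the rectangle carries [lam/mu] to [mu^v/lam^v]; this is the
    source of the symmetry between shape and content. *)
Lemma horizontal_strip_dual lam mu p :
  horizontal_strip (dual_part mu) (dual_part lam) p = horizontal_strip lam mu p.
Proof.
rewrite !horizontal_stripE hstrip_dual; congr (_ && _).
by have := weight_dual lam; have := weight_dual mu; lia.
Qed.

End Rows.

(** * Chains of horizontal strips and the cancelling involution *)

Lemma sum_involution_eq0 (I : finType) (Q : pred I) (F : I -> int) (phi : I -> I) :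
  (forall x, Q x -> [/\ Q (phi x), phi (phi x) = x & F (phi x) = - F x]%R) ->
  (\sum_(x | Q x) F x = 0)%R.
Proof.
move=> H; suff : (\sum_(x | Q x) F x = - \sum_(x | Q x) F x)%R by lia.
rewrite [LHS](reindex_onto phi phi); last by move=> x /H[].
rewrite -sumrN; apply: eq_big => [x|x]; last first.
  by move=> /andP[/H[Q' _ E] /eqP xE]; rewrite xE in E; rewrite E opprK.
apply/andP/idP => [[/H[Q' _ _] /eqP <-]//|/H[Q' E _]]; by rewrite E.
Qed.

Section Chains.
Variables k m : nat.
Notation part := (rect_part k m).
Variable mu : part.

(** Row lengths of the [j]-th partition of the chain starting at [mu]; level [0]
    is [mu] itself, so that entry [j] of [t] is level [j.+1]. *)
Definition level (t : seq part) (j : nat) : nat -> nat := row_len (nth mu (mu :: t) j).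

Definition jumps (t : seq part) : seq nat :=
  pairmap (fun a b => weight b - weight a)%N mu t.

Definition is_chain (t : k.-tuple part) : bool := path (@hstrip k m) mu t.

Lemma chainP (t : k.-tuple part) :
  reflect (forall j, (j < k)%N -> interlace (level t j) (level t j.+1)) (is_chain t).
Proof.
apply: (iffP (pathP mu)) => H j; rewrite ?size_tuple => jk.
  by apply/hstripP/H; rewrite size_tuple.
exact/hstripP/H.
Qed.

Lemma jumpE (t : k.-tuple part) j : is_chain t -> (j < k)%N ->
  (nth 0 (jumps t) j + psum (level t j) k = psum (level t j.+1) k)%N.
Proof.
move=> ct jk; rewrite (nth_pairmap mu) ?size_tuple // -!weightE subnK //.
by apply: hstrip_weight; apply: (pathP _ ct); rewrite size_tuple.
Qed.

Lemma level_mono (t : k.-tuple part) x i j : is_chain t -> (i <= j <= k)%N ->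
  (level t i x <= level t j x)%N.
Proof.
move=> /chainP ct /andP[ij jk]; elim: j ij jk => [|j IHj].
  by rewrite leqn0 => /eqP ->.
rewrite leq_eqVlt => /orP[/eqP -> //|]; rewrite ltnS => ij jk.
by apply: leq_trans (IHj ij (ltnW jk)) _; case: (ct j jk x).
Qed.

Lemma level_inj (t u : k.-tuple part) :
  (forall j x, (j <= k)%N -> level t j x = level u j x) -> t = u.
Proof.
move=> tu; apply/val_inj/(@eq_from_nth _ mu); rewrite ?size_tuple // => j jk.
by apply: row_len_inj => x; apply: (tu j.+1).
Qed.

(** For [p = (r, i)]: the tableau of the chain has too many letters [i + 2],
    compared with [i + 1], by the end of row [r]. *)
Definition violation (t : seq part) (p : 'I_k * 'I_k) : bool :=
  (p.2.+1 < k)%N &&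
  overflow (level t p.2) (level t p.2.+1) (level t p.2.+2) p.1.

Definition lattice_chain (t : seq part) : bool := [forall p, ~~ violation t p].

(** The smallest row, and in that row the largest letter.  Changing level [i + 1]
    from row [r] on can affect the comparison of the letters [i] and [i + 1] in
    row [r], but not those between larger letters; taking the largest letter
    therefore makes the choice invariant under the involution. *)
Definition first_violation (t : seq part) (p : 'I_k * 'I_k) : bool :=
  violation t p &&
  [forall q, violation t q ==> (p.1 < q.1)%N || (p.1 == q.1) && (q.2 <= p.2)%N].

(** Encodes the order of [first_violation] (row ascending, letter descending) in
    a single number, to be minimized. *)
Lemma lex_of_code (r i r' i' : 'I_k) : (r * k + (k - i) <= r' * k + (k - i'))%N ->
  (r < r')%N || (r == r') && (i' <= i)%N.
Proof.
rewrite -(inj_eq val_inj) /=; move: (ltn_ord i) (ltn_ord i').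
move: (val i) (val i') (val r) (val r') => {}i {}i' {}r {}r' /= ik ik' code.
have : (r <= r')%N.
  rewrite leqNgt; apply/negP => lt; have := leq_mul lt (leqnn k).
  by rewrite mulSn; lia.
by rewrite leq_eqVlt => /orP[/eqP e|->//]; rewrite e eqxx ltnn /=; lia.
Qed.

Lemma first_violation_exists t : ~~ lattice_chain t -> exists p, first_violation t p.
Proof.
move=> /forallPn[p0]; rewrite negbK => b0.
pose f (p : 'I_k * 'I_k) := (p.1 * k + (k - p.2))%N.
case: (@arg_minnP _ p0 (violation t) f b0) => p bp pmin.
exists p; apply/andP; split=> //; apply/forallP => q; apply/implyP => bq.
exact: lex_of_code (pmin q bq).
Qed.

Lemma first_violation_uniq t p q : first_violation t p -> first_violation t q -> p = q.
Proof.
move=> /andP[bp /forallP/(_ q)/implyP pmin] /andP[bq /forallP/(_ p)/implyP qmin].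
have := pmin bq; have := qmin bp.
have [e|ne] := eqVneq p.1 q.1; last first.
  by rewrite /= !orbF => lt /(ltn_trans lt); rewrite ltnn.
rewrite e ltnn /= => a b.
case: p q e a b {bp bq pmin qmin} => [r i] [r' i'] /= -> a b.
by congr pair; apply/val_inj/eqP; rewrite eqn_leq a b.
Qed.

Lemma first_violation_under (t : seq part) r i : first_violation t (r, i) ->
  [/\ (i.+1 < k)%N,
      overflow (level t i) (level t i.+1) (level t i.+2) r
    & forall x, (x < r)%N -> ~~ overflow (level t i) (level t i.+1) (level t i.+2) x].
Proof.
case/andP => /andP[/= ik ov] /forallP H; split=> // x xr.
have xk := ltn_trans xr (ltn_ord r).
apply/negP => ox; have := H (Ordinal xk, i); rewrite /violation /= ik ox /= ltnNge (ltnW xr) /=.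
by move=> /andP[/eqP e _]; move: xr; rewrite e ltnn.
Qed.

Definition flip (t : k.-tuple part) (p : 'I_k * 'I_k) : k.-tuple part :=
  [tuple if j == p.2
         then part_of k m (toggle (level t p.2) (level t p.2.+2) (level t p.2.+1) p.1)
         else tnth t j | j < k].

Section Flip.
Variables (t : k.-tuple part) (r i : 'I_k).
Hypothesis ct : is_chain t.
Hypothesis ft : first_violation t (r, i).

Let ik : (i.+1 < k)%N. Proof. by case: (first_violation_under ft). Qed.
Let over_r : overflow (level t i) (level t i.+1) (level t i.+2) r.
Proof. by case: (first_violation_under ft). Qed.
Let under_r : forall x, (x < r)%N ->
  ~~ overflow (level t i) (level t i.+1) (level t i.+2) x.
Proof. by case: (first_violation_under ft). Qed.
Let low : interlace (level t i) (level t i.+1).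
Proof. exact: (chainP _ ct). Qed.
Let up : interlace (level t i.+1) (level t i.+2).
Proof. exact: (chainP _ ct). Qed.
Let tog := toggle (level t i) (level t i.+2) (level t i.+1) r.
Let low' : interlace (level t i) tog. Proof. exact: toggle_interlace_low. Qed.
Let up' : interlace tog (level t i.+2). Proof. exact: toggle_interlace_up. Qed.

Lemma level_flip j x : (j <= k)%N ->
  level (flip t (r, i)) j x = if j == i.+1 then tog x else level t j x.
Proof.
case: j => [|j] // jk.
have -> : level (flip t (r, i)) j.+1 = row_len (tnth (flip t (r, i)) (Ordinal jk)).
  by rewrite (tnth_nth mu).
rewrite tnth_mktuple eqSS -(inj_eq val_inj) /=; case: eqP => _; last first.
  by rewrite (tnth_nth mu).
apply: row_part_of => [y||y ky].
- by case: (low' y) => a _; case: (up' y) => _ b; case: (low' y) => _ c; apply: leq_trans c a.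
- by apply: leq_trans (row_len_max _ _); case: (up' 0%N) => a _; exact: a.
by apply/eqP; rewrite -leqn0 -(row_len_out (nth mu (mu :: t) i.+2) ky); case: (up' y).
Qed.

Lemma flip_chain : is_chain (flip t (r, i)).
Proof.
have ct' := chainP _ ct.
apply/chainP => j jk x; rewrite !(level_flip _ jk) !(level_flip _ (ltnW jk)) eqSS.
have [->|ji] := eqVneq j i; first by rewrite -[_ == _]/(val i == i.+1) ltn_eqF //; exact: low'.
have [->|ji1] := eqVneq j i.+1; first exact: up'.
exact: ct'.
Qed.

Lemma flip_last : last mu (flip t (r, i)) = last mu t.
Proof.
have lastE (u : k.-tuple part) : last mu u = nth mu (mu :: u) k.
  by rewrite (last_nth mu) size_tuple.
rewrite !lastE; apply: row_len_inj => x.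
have := @level_flip k x (leqnn k); rewrite /level => ->.
by rewrite gtn_eqF.
Qed.

(** In the rows above [r] nothing changes, and in row [r] no comparison
    of index above [i] involves the modified part of level [i + 1]; the one of
    index [i] persists by [toggle_overflow]. *)
Lemma violation_flip (q : 'I_k * 'I_k) :
  (q.1 < r)%N || (q.1 == r) && (i <= q.2)%N ->
  violation (flip t (r, i)) q = violation t q.
Proof.
case: q => x j /= xj; rewrite /violation /=; have [jk|//] := ltnP j.+1 k; rewrite /=.
have xr : (x <= r)%N by case/orP: xj => [/ltnW//|/andP[/eqP -> //]].
have ps n l : (l <= k)%N -> (n <= r)%N ->
    psum (level (flip t (r, i)) l) n = psum (level t l) n.
  move=> lk nr; apply: eq_psum => y yn; rewrite level_flip //; case: eqP => // ->.
  exact: toggle_below (leq_trans yn nr).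
have psn n l : (l <= k)%N -> l != i.+1 ->
    psum (level (flip t (r, i)) l) n = psum (level t l) n.
  by move=> lk li; apply: eq_psum => y yn; rewrite level_flip // (negbTE li).
have [ji|ji] := eqVneq j i.
  rewrite ji -(toggle_overflow low up over_r xr) /overflow.
  have i2 : i.+2 != i.+1 by rewrite gtn_eqF.
  have i0 : val i != i.+1 by rewrite ltn_eqF.
  rewrite (psn _ _ ik i2) (psn _ i _ i0) ?(ltnW (ltnW ik)) //.
  have E n : psum (level (flip t (r, i)) i.+1) n = psum tog n.
    by apply: eq_psum => y _; rewrite level_flip ?eqxx // ltnW.
  by rewrite !E.
have {}ji : val j != i by rewrite (inj_eq val_inj).
case/orP: xj => [x_r|/andP[_ ij]].
  by rewrite /overflow !ps // ltnW // ltnW.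
have jk1 := ltnW jk; have jk0 := ltnW jk1.
rewrite /overflow (psn _ j.+2) // ?(psn _ j.+1) // ?(ps _ j) //.
by rewrite eqSS eq_sym ltn_eqF // ltnS ltn_neqAle eq_sym ji.
Qed.

Lemma flip_first_violation : first_violation (flip t (r, i)) (r, i).
Proof.
case/andP: (ft) => bt /forallP H.
apply/andP; split; first by rewrite violation_flip //= eqxx leqnn orbT.
apply/forallP => q; apply/implyP => /= bq.
have [xj|] := boolP ((q.1 < r)%N || (q.1 == r) && (i <= q.2)%N).
  by move: bq; rewrite violation_flip // => bq; exact: (implyP (H q)).
rewrite negb_or -leqNgt leq_eqVlt (eq_sym r) => /andP[/orP[/eqP e|->//]].
have -> : q.1 == r by apply/eqP/val_inj.
by rewrite /= -ltnNge => /ltnW ->; rewrite orbT.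
Qed.

Lemma flip_jump j : (j < k)%N ->
  let a := nth 0%N (jumps t) in
  nth 0%N (jumps (flip t (r, i))) j =
  if j == i then (a i.+1).-1 else if j == i.+1 then (a i).+1 else a j.
Proof.
move=> jk a; have ek1 := ltnW ik; have ek0 := ltnW ek1.
have E l : (l <= k)%N -> psum (level (flip t (r, i)) l) k =
    if l == i.+1 then psum tog k else psum (level t l) k.
  move=> lk; have [e|e] := eqVneq l i.+1; apply: eq_psum => y _; rewrite level_flip //.
    by rewrite e eqxx.
  by rewrite (negbTE e).
have := jumpE flip_chain jk; rewrite (E _ jk) (E _ (ltnW jk)) eqSS.
have := toggle_size low up over_r (ltn_ord r) (row_len_out _ (leqnn k)).
rewrite -/tog.
have := jumpE ct (ltn_ord i); have := jumpE ct ik; have := jumpE ct jk.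
rewrite -/(a i) -/(a i.+1) -/(a j).
have [->|ji] := eqVneq j i; first by rewrite ltn_eqF //; lia.
have [->|ji1] := eqVneq j i.+1; first by lia.
by lia.
Qed.

(** Hence the predecessor in [flip_jump] is not truncated. *)
Lemma first_jump_gt0 : (0 < nth 0%N (jumps t) i.+1)%N.
Proof.
have := jumpE ct ik; have := toggle_size low up over_r (ltn_ord r) (row_len_out _ (leqnn k)).
rewrite -/tog; have : (psum (level t i) k <= psum tog k)%N.
  by apply: leq_sum => x _; case: (low' x).
by lia.
Qed.
End Flip.

Lemma flipK (t : k.-tuple part) p : is_chain t -> first_violation t p -> flip (flip t p) p = t.
Proof.
case: p => r i ct ft; have fc := flip_chain ct ft; have ff := flip_first_violation ct ft.
have [ik ov un] := first_violation_under ft.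
have ct' := chainP _ ct.
apply: level_inj => j x jk.
rewrite (level_flip fc ff) // (level_flip ct ft) //; case: eqP => // ->.
rewrite -[RHS](@toggleK (level t i) (level t i.+1) (level t i.+2) r) //; first last.
- exact: ct'.
- exact: ct'.
suff E a b c a' b' c' : a =1 a' -> b =1 b' -> c =1 c' ->
    toggle a b c r x = toggle a' b' c' r x.
  have off l y : (l <= k)%N -> l != i.+1 -> level (flip t (r, i)) l y = level t l y.
    by move=> lk li; rewrite (level_flip ct ft) // (negbTE li).
  apply: E => y; last by rewrite (level_flip ct ft) ?eqxx // ltnW.
    by apply: off; rewrite ?ltn_eqF // ltnW // ltnW.
  by apply: off; rewrite ?gtn_eqF.
move=> ea eb ec; rewrite /toggle !ea !eb !ec.
by rewrite !(eq_psum (f := b) (g := b')) // !(eq_psum (f := a) (g := a')) //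
  !(eq_psum (f := c) (g := c')).
Qed.

End Chains.

(** * The signed count of chains *)

Lemma increasing_perm k (s : 'S_k) :
  (forall i j : 'I_k, (i < j)%N -> (s i < s j)%N) -> s = 1%g.
Proof.
have ge (u : 'S_k) : (forall i j : 'I_k, (i < j)%N -> (u i < u j)%N) ->
    forall i : 'I_k, (i <= u i)%N.
  move=> uP [i ik]; elim: i ik => [//|i IHi] ik /=.
  by apply: leq_ltn_trans (IHi (ltnW ik)) _; apply: uP => /=.
move=> sP; apply/permP => i; rewrite perm1; apply/val_inj/eqP.
rewrite eqn_leq (ge s) // andbT -{2}(permK s i).
apply: (ge s^-1)%g => a b ab; rewrite ltnNge leq_eqVlt negb_or.
apply/andP; split.
  by rewrite (inj_eq val_inj) (inj_eq perm_inj) -(inj_eq val_inj) /= gtn_eqF.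
by apply/negP => /sP; rewrite !permKV ltnNge ltnW.
Qed.

Section SignedCount.
Variables k m : nat.
Notation part := (rect_part k m).
Implicit Types (lam mu nu : part) (t : k.-tuple part) (s : 'S_k).

Definition has_content mu lam t : bool :=
  [forall i : 'I_k, nth 0%N (jumps mu t) i == lam i].

(** The [i]-th strip has [lam (s i) + i - s i] boxes, the index of the factor in
    row [s i] and column [i] of the Giambelli determinant; the equation avoids
    truncated subtraction. *)
Definition shifted_content mu lam s t : bool :=
  [forall i : 'I_k, (nth 0 (jumps mu t) i + s i == lam (s i) + i)%N].

Definition LR_chains mu nu lam : {pred k.-tuple part} :=
  [pred t | [&& is_chain mu t, last mu t == nu, has_content mu lam t & lattice_chain mu t]].

(** The content of a lattice chain is a partition: at the last row, the absence of
    overflow compares all letters [j + 2] with a part of the letters [j + 1]. *)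
Lemma lattice_jumps mu t i j : is_chain mu t -> lattice_chain mu t -> (i <= j < k)%N ->
  (nth 0 (jumps mu t) j <= nth 0 (jumps mu t) i)%N.
Proof.
move=> ct /forallP lt /andP[ij jk]; elim: j ij jk => [|j IHj].
  by rewrite leqn0 => /eqP ->.
rewrite leq_eqVlt => /orP[/eqP -> //|]; rewrite ltnS => ij jk.
apply: leq_trans (IHj ij (ltnW jk)).
have kE : k.-1.+1 = k by rewrite prednK // (leq_ltn_trans _ jk).
have pk f : psum f k = (psum f k.-1 + f k.-1)%N by rewrite -psumS kE.
have k1 : (k.-1 < k)%N by rewrite -[X in (_ < X)%N]kE.
have := lt (Ordinal k1, Ordinal (ltnW jk)); rewrite /violation /= jk /= /overflow kE -leqNgt.
have := jumpE ct jk; have := jumpE ct (ltnW jk).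
have : (psum (level mu t j) k <= psum (level mu t j) k.-1 + level mu t j.+1 k.-1)%N.
  rewrite pk leq_add2l.
  by case: (chainP _ _ ct j (ltnW jk) k.-1).
by rewrite (pk (level mu t j.+1)); lia.
Qed.

(** The strip sizes decrease weakly, so [lam (s i) - s i] decreases strictly
    with [i]; as [lam j - j] does too, [s] is increasing. *)
Lemma lattice_shift1 mu lam s t : is_chain mu t -> lattice_chain mu t ->
  shifted_content mu lam s t -> s = 1%g.
Proof.
move=> ct lt /forallP sc; apply: increasing_perm => i j ij.
have := @lattice_jumps mu t i j ct lt; rewrite (ltnW ij) ltn_ord => /(_ isT).
have := eqP (sc i); have := eqP (sc j).
rewrite -!row_len_ord => ej ei aij.
rewrite ltnNge leq_eqVlt; apply/negP => /orP[/eqP e|sij].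
  by move/val_inj/perm_inj: e ij => ->; rewrite ltnn.
by have := row_len_anti lam (ltnW sij); lia.
Qed.

Lemma shifted_content1 mu lam t : shifted_content mu lam 1 t = has_content mu lam t.
Proof. by apply: eq_forallb => i; rewrite perm1 eqn_add2r. Qed.

Definition next_ord (i : 'I_k) : 'I_k := insubd i i.+1.

Lemma next_ordE (i : 'I_k) : (i.+1 < k)%N -> next_ord i = i.+1 :> nat.
Proof. by move=> ik; rewrite val_insubd ik. Qed.

Definition flip_pair mu (x : 'S_k * k.-tuple part) : 'S_k * k.-tuple part :=
  if [pick p | first_violation mu x.2 p] is Some p
  then ((tperm p.2 (next_ord p.2) * x.1)%g, flip mu x.2 p) else x.

Lemma flip_pairE mu (x : 'S_k * k.-tuple part) p : first_violation mu x.2 p ->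
  flip_pair mu x = ((tperm p.2 (next_ord p.2) * x.1)%g, flip mu x.2 p).
Proof.
rewrite /flip_pair => fp; case: pickP => [q fq|/(_ p)]; last by rewrite fp.
by rewrite (first_violation_uniq fp fq).
Qed.

(** Exchanging the rows assigned to the columns [i] and [i + 1] of the determinant
    exchanges the two strip sizes up to the same shift by one as [toggle_size]. *)
Lemma flip_shifted_content mu lam s t r i : is_chain mu t -> first_violation mu t (r, i) ->
  shifted_content mu lam s t ->
  shifted_content mu lam (tperm i (next_ord i) * s)%g (flip mu t (r, i)).
Proof.
move=> ct ft /forallP sc; have [ik _ _] := first_violation_under ft.
have a0 := first_jump_gt0 ct ft.
apply/forallP => j; rewrite permM flip_jump //.
have := eqP (sc (next_ord i)); have := eqP (sc i); rewrite next_ordE //.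
case: tpermP => [->|->|/eqP ji /eqP ji1].
- by rewrite eqxx; lia.
- by rewrite next_ordE // eqxx (gtn_eqF (ltnSn i)); lia.
have -> : (val j == i) = false by apply/negbTE; rewrite (inj_eq val_inj).
have -> : (val j == i.+1) = false by apply/negbTE; rewrite -(next_ordE ik) (inj_eq val_inj).
by rewrite (eqP (sc j)) eqxx.
Qed.

(** The terms cancel in pairs except for the lattice chains, which occur only
    with the identity permutation. *)
Lemma signed_count mu nu lam :
  (\sum_(x : 'S_k * k.-tuple part |
       [&& is_chain mu x.2, last mu x.2 == nu & shifted_content mu lam x.1 x.2])
     (-1) ^+ x.1 = #|LR_chains mu nu lam|%:Z)%R.
Proof.
rewrite (bigID (fun x : 'S_k * k.-tuple part => lattice_chain mu x.2)) /=.
rewrite [X in (_ + X)%R](_ : _ = 0%R) ?addr0.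
  rewrite (reindex_onto (fun t => (1%g, t)) snd) /=; last first.
    by move=> [s t] /= /andP[/and3P[ct _ sc] lt]; rewrite (lattice_shift1 ct lt sc).
  rewrite -natz -sumr_const; apply: eq_big => [t|t _].
    by rewrite eqxx andbT shifted_content1 inE -!andbA.
  by rewrite odd_perm1 expr0.
apply: (@sum_involution_eq0 _ _ _ (flip_pair mu)) => -[s t] /=.
move=> /andP[/and3P[ct lt sc] /first_violation_exists[[r i] ft]].
have fE := @flip_pairE mu (s, t) (r, i) ft; have ff := flip_first_violation ct ft.
have [ik _ _] := first_violation_under ft.
rewrite fE /=; split.
- rewrite flip_chain // flip_last // lt flip_shifted_content //=.
  by apply/forallPn; exists (r, i); rewrite negbK; case/andP: ff.
- by rewrite (@flip_pairE mu (_, _) (r, i) ff) /= mulgA tperm2 mul1g flipK.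
rewrite odd_permM odd_tperm -(inj_eq val_inj) /= next_ordE // ltn_eqF //.
by rewrite signr_addb expr1 mulN1r.
Qed.

(** * Littlewood-Richardson chains from the empty partition *)

Section FromEmpty.
Variables (t : k.-tuple part).
Notation emp := (empty_part k m).
Hypothesis ct : is_chain emp t.

Lemma chain_empty_above j x : (j <= x)%N -> (j <= k)%N -> level emp t j x = 0%N.
Proof.
elim: j x => [|j IHj] x; first by rewrite /level /= row_empty.
case: x => // x jx jk; have [_ +] := chainP _ _ ct j jk x.
by rewrite (IHj x jx (ltnW jk)) leqn0 => /eqP.
Qed.

Hypothesis lt : lattice_chain emp t.

(** Column strictness confines row [x] to letters [>= x + 1], the lattice
    condition to letters [<= x + 1]: the latter by induction on [x], since rows
    above contain no letter [> x] to compare with. *)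
Lemma lattice_chain_empty_const x j : (x < j)%N -> (j < k)%N ->
  level emp t j.+1 x = level emp t j x.
Proof.
elim/ltn_ind: x j => x IH; case=> [//|j]; rewrite ltnS => xj jk.
have xk : (x < k)%N by rewrite (leq_ltn_trans xj) // ltnW.
have := forallP lt (Ordinal xk, Ordinal (ltnW jk)).
rewrite /violation /= jk /= /overflow -leqNgt !psumS.
have -> : psum (level emp t j.+2) x = psum (level emp t j.+1) x.
  by apply: eq_psum => y yx; rewrite IH // (ltn_trans yx) // ltnS.
have -> : psum (level emp t j.+1) x = psum (level emp t j) x.
  by apply: eq_psum => y yx; rewrite IH // ?(leq_trans yx) // ltnW.
case: (chainP _ _ ct j.+1 jk x); lia.
Qed.

Lemma lattice_chain_empty_level j x : (j <= k)%N ->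
  level emp t j x = if (x < j)%N then row_len (last emp t) x else 0%N.
Proof.
move=> jk; case: ltnP => xj; last exact: chain_empty_above.
rewrite (last_nth emp) size_tuple -/(level emp t k).
have const d : (j + d <= k)%N -> level emp t (j + d) x = level emp t j x.
  elim: d => [|d IHd]; first by rewrite addn0.
  rewrite addnS => jd; rewrite lattice_chain_empty_const ?(IHd (ltnW jd)) //.
  exact: leq_trans xj (leq_addr _ _).
by have := const (k - j)%N; rewrite subnKC // => ->.
Qed.

End FromEmpty.

(** The chain of the tableau of straight shape [lam] whose [x]-th row is filled
    with [x + 1]. *)
Definition staircase lam : k.-tuple part :=
  [tuple part_of k m (fun x => if (x <= j)%N then row_len lam x else 0%N) | j < k].

Notation emp := (empty_part k m).

Lemma level_staircase lam j x : (j <= k)%N ->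
  level emp (staircase lam) j x = if (x < j)%N then row_len lam x else 0%N.
Proof.
case: j => [|j] jk; first by rewrite /level /= row_empty.
have -> : level emp (staircase lam) j.+1 = row_len (tnth (staircase lam) (Ordinal jk)).
  by rewrite (tnth_nth emp).
rewrite tnth_mktuple row_part_of //= => [y||y ky].
- by case: ltnP => // yj; rewrite (ltnW yj); exact: row_len_anti.
- exact: row_len_max.
- by rewrite row_len_out //; case: ifP.
Qed.

Lemma staircase_chain lam : is_chain emp (staircase lam).
Proof.
apply/chainP => j jk x; rewrite !(level_staircase _ _ jk) !(level_staircase _ _ (ltnW jk)) !ltnS.
case: (ltngtP x j) => //= _; split=> //; exact: row_len_anti (leqnSn x).
Qed.

Lemma last_staircase lam : last emp (staircase lam) = lam.
Proof.
apply: row_len_inj => x; rewrite (last_nth emp) size_tuple.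
rewrite -/(level emp (staircase lam) k) level_staircase //.
by case: ltnP => // kx; rewrite row_len_out.
Qed.

Lemma psum_staircase lam j n : (j <= k)%N ->
  psum (level emp (staircase lam) j) n = psum (row_len lam) (minn j n).
Proof.
move=> jk; elim: n => [|n IHn]; first by rewrite minn0 !psum0.
rewrite psumS IHn level_staircase //; case: ltnP => nj.
  by rewrite !(minn_idPr _) ?psumS // ltnW.
by rewrite !(minn_idPl _) ?addn0 // ltnW.
Qed.

Lemma staircase_content lam : has_content emp lam (staircase lam).
Proof.
apply/forallP => i; have := jumpE (staircase_chain lam) (ltn_ord i).
rewrite !psum_staircase // 1?ltnW // !(minn_idPl _) // 1?ltnW // psumS -row_len_ord.
by move/eqP; rewrite addnC eqn_add2l.
Qed.

Lemma staircase_lattice lam : lattice_chain emp (staircase lam).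
Proof.
apply/forallP => -[r i]; rewrite /violation /=; case: (ltnP i.+1 k) => //= ik.
rewrite /overflow -leqNgt !psum_staircase //; try by rewrite ltnW // ltnW.
have [ri|ir] := leqP r i.
  have -> : (minn i.+2 r.+1 = r.+1)%N by lia.
  have -> : (minn i.+1 r.+1 = r.+1)%N by lia.
  have -> : (minn i.+1 r = r)%N by lia.
  by [].
have -> : (minn i.+2 r.+1 = i.+2)%N by lia.
have -> : (minn i.+1 r.+1 = i.+1)%N by lia.
have -> : (minn i.+1 r = i.+1)%N by lia.
have := row_len_anti lam (leqnSn i).
by rewrite !psumS; lia.
Qed.

Lemma LR_chain_empty lam nu t : t \in LR_chains emp nu lam ->
  t = staircase nu /\ lam = nu.
Proof.
case/and4P => ct /eqP tnu /forallP clam lt.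
have tE : t = staircase nu.
  apply: (@level_inj _ _ emp) => j x jk.
  by rewrite lattice_chain_empty_level // tnu level_staircase.
split=> //; apply: row_len_inj => x; have [xk|kx] := ltnP x k; last by rewrite !row_len_out.
have := forallP (staircase_content nu) (Ordinal xk).
by have := clam (Ordinal xk); rewrite tE -!row_len_ord /= => /eqP -> /eqP.
Qed.

Lemma card_LR_chains_empty lam nu : #|LR_chains emp nu lam| = (lam == nu).
Proof.
have [->|ne] := eqVneq lam nu; last first.
  apply: eq_card0 => t; apply/negP => /LR_chain_empty[_ e].
  by rewrite e eqxx in ne.
transitivity #|pred1 (staircase nu)|; last exact: card1.
apply: eq_card => t; rewrite [RHS]inE.
apply/idP/eqP => [/LR_chain_empty[]//|->].
by rewrite inE staircase_chain last_staircase eqxx staircase_content staircase_lattice.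
Qed.
End SignedCount.

(** * Chains as fillings, and the reading word *)

Lemma lattice_wordP (w : seq nat) : lattice_word w <->
  forall i j, (count_mem i.+2 (take j w) <= count_mem i.+1 (take j w))%N.
Proof.
split=> [H i j|H [//|i] j _ _]; last exact: H.
have [->|j0] := posnP j; first by rewrite take0.
have [jw|wj] := leqP j (size w); first by apply: H; rewrite ?j0.
rewrite take_oversize ?(ltnW wj) // -[w]take_size.
have [/size0nil -> //|w0] := posnP (size w).
by apply: H; rewrite ?w0 /=.
Qed.

Lemma take_sorted_geq (v : nat) (w : seq nat) : sorted geq w ->
  take (count (leq v) w) w = [seq y <- w | leq v y].
Proof.
elim: w => //= y w IHw pw; have sw := path_sorted pw.
case: leqP => [vy|yv]; first by rewrite add1n /= IHw.
have lt : all (gtn v) w.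
  have tr : transitive geq by move=> a b c ab bc; apply: leq_trans bc ab.
  apply: sub_all (order_path_min tr pw) => z /= zy; exact: leq_ltn_trans zy yv.
have nw : ~~ has (leq v) w.
  by apply/hasPn => z /(allP lt) /=; rewrite ltnNge.
by move: nw; rewrite has_count -leqNgt leqn0 add0n => /eqP c0; rewrite c0 take0;
  apply/esym/eqP; rewrite -size_eq0 size_filter c0.
Qed.

Lemma take_flatten (T : Type) (ss : seq (seq T)) j : (0 < size ss)%N ->
  exists r n, (r < size ss)%N /\
    take j (flatten ss) = flatten (take r ss) ++ take n (nth [::] ss r).
Proof.
elim: ss j => // w ss IHss j _.
have [jw|wj] := leqP j (size w).
  by exists 0%N, j; split=> //=; rewrite takel_cat.
have [/size0nil ->|ss0] := posnP (size ss).
  by exists 0%N, j; split=> //=; rewrite cats0.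
have [r [n [rs E]]] := IHss (j - size w)%N ss0.
exists r.+1, n; split=> //=; rewrite take_cat ltnNge (ltnW wj) /= E catA //.
Qed.

(** A downward closed subset of an interval is determined by its cardinal. *)
Lemma initial_segment m (P : pred 'I_m) (a b : nat) (c : 'I_m) : (b <= m)%N ->
  (forall x y : 'I_m, (a <= x)%N -> (x <= y)%N -> (y < b)%N -> P y -> P x) ->
  (a <= c < b)%N ->
  P c = (c < a + #|[pred x : 'I_m | (a <= x < b)%N & P x]|)%N.
Proof.
move=> bm Pd /andP[ac cb]; apply/idP/idP => [Pc|].
  have : (#|[pred x : 'I_m | (a <= x < c.+1)%N]|
      <= #|[pred x : 'I_m | (a <= x < b)%N & P x]|)%N.
    apply/subset_leq_card/fintype.subsetP => x; rewrite !inE ltnS => /andP[ax xc].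
    by rewrite ax (leq_ltn_trans xc cb) (Pd x c).
  by rewrite card_skew_row //; lia.
apply: contraTT => nPc; rewrite -leqNgt.
have : (#|[pred x : 'I_m | (a <= x < b)%N & P x]|
    <= #|[pred x : 'I_m | (a <= x < c)%N]|)%N.
  apply/subset_leq_card/fintype.subsetP => x; rewrite !inE => /andP[/andP[ax xb] Px].
  rewrite ax ltnNge; apply/negP => cx; by rewrite (Pd c x) in nPc.
by rewrite (card_skew_row _ (ltnW (ltn_ord c))); lia.
Qed.

Section Fillings.
Variables (k m : nat) (lam mu : rect_part k m).
Notation part := (rect_part k m).
Implicit Types (T : filling k m) (N : k.-tuple part).

(** The filling and the chain describe the same tableau: level [v] is the union
    of [mu] and the boxes with entries at most [v]. *)
Definition fills T N : Prop := forall r c v, in_skew lam mu r c -> (v <= k)%N ->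
  (T (r, c) <= v)%N = (c < level mu N v r)%N.

Section Chain.
Variable N : k.-tuple part.
Hypothesis cN : is_chain mu N.
Hypothesis lN : last mu N = lam.

Lemma level_first x : level mu N 0 x = row_len mu x.
Proof. by []. Qed.

Lemma level_last x : level mu N k x = row_len lam x.
Proof. by rewrite -lN (last_nth mu) size_tuple. Qed.

Lemma chain_skew (r : 'I_k) (v : nat) : (v <= k)%N ->
  (mu r <= level mu N v r)%N /\ (level mu N v r <= lam r)%N.
Proof.
move=> vk; rewrite -!row_len_ord -level_first -level_last.
by rewrite !level_mono //= ?vk ?leqnn.
Qed.

(** The entry of a box is the number of levels, [mu] included, that do not
    contain it. *)
Definition chain_filling : filling k m :=
  [ffun b => if in_skew lam mu b.1 b.2
             then inord #|[pred j : 'I_k.+1 | (level mu N j b.1 <= b.2)%N]| else ord0].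

Lemma chain_filling_fills : fills chain_filling N.
Proof.
move=> r c v rc vk; rewrite ffunE /= rc.
have key w : (w <= k)%N ->
    (#|[pred j : 'I_k.+1 | (level mu N j r <= c)%N]| <= w)%N = (c < level mu N w r)%N.
  move=> wk; have cardw u : (u <= k.+1)%N -> #|[pred j : 'I_k.+1 | (0 <= j < u)%N]| = u.
    by move=> uk; rewrite card_skew_row // subn0.
  apply/idP/idP => [|cw].
    apply: contraTT; rewrite -leqNgt -ltnNge => wc.
    rewrite -[X in (X <= _)%N](cardw w.+1) //; apply/subset_leq_card/fintype.subsetP => j.
    rewrite !inE /= ltnS => jw; apply: leq_trans wc; apply: level_mono => //.
    by rewrite jw.
  rewrite -[X in (_ <= X)%N](cardw w) ?leqW //; apply/subset_leq_card/fintype.subsetP => j.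
  rewrite !inE /= => jc; rewrite ltnNge; apply/negP => wj.
  have := level_mono r cN (i := w) (j := j); rewrite wj -ltnS ltn_ord => /(_ isT).
  by lia.
rewrite inordK ?key // ltnS key // level_last row_len_ord.
by case/andP: rc.
Qed.

Lemma chain_filling_tableau : is_tableau lam mu chain_filling.
Proof.
have sp := chain_filling_fills.
split=> [r c|r c c' rc rc' cc'|r r' c rc rc' rr'].
- case: (boolP (in_skew lam mu r c)) => [rc|nrc]; last by rewrite ffunE /= (negbTE nrc).
  rewrite ltnNge (sp r c 0%N) // level_first row_len_ord -leqNgt.
  by case/andP: rc.
- have vk : (chain_filling (r, c') <= k)%N by rewrite -ltnS.
  by rewrite (sp r c) // (leq_ltn_trans cc') // -(sp r c').
have vk : (chain_filling (r', c) <= k)%N by rewrite -ltnS.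
have := sp r' c _ rc' vk; rewrite leqnn => /esym.
case: (val (chain_filling (r', c))) vk => [|v] vk.
  rewrite level_first row_len_ord ltnNge; case/andP: rc' => -> //.
move=> cv; rewrite ltnS (sp r c _ rc (ltnW vk)).
apply: leq_trans cv _; apply: leq_trans (row_len_anti _ rr') _.
by case: (chainP _ _ cN v vk r).
Qed.

Section Filled.
Variable T : filling k m.
Hypothesis tT : is_tableau lam mu T.
Hypothesis sp : fills T N.

Lemma filling_row (r : 'I_k) v : (v < k)%N ->
  (#|[pred c | in_skew lam mu r c & T (r, c) == v.+1 :> nat]| + level mu N v r =
   level mu N v.+1 r)%N.
Proof.
move=> vk; have [m0 _] := chain_skew r (ltnW vk); have [_ l1] := chain_skew r vk.
have lv : (level mu N v r <= level mu N v.+1 r)%N by apply: level_mono; rewrite // leqnSn vk.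
rewrite -[RHS](subnK lv); congr (_ + _)%N.
rewrite -(@card_skew_row m); last exact: row_len_max.
apply: eq_card => c; rewrite !inE; apply/andP/andP => [[rc /eqP Tv]|[vc cv]].
  have := sp rc vk; have := sp rc (ltnW vk); rewrite Tv leqnn ltnn => /esym/negbT.
  by rewrite -leqNgt => -> <-.
have rc : in_skew lam mu r c by apply/andP; split; lia.
split=> //; rewrite eqn_leq (sp rc vk) cv ltnNge (sp rc (ltnW vk)) -leqNgt //.
Qed.

Lemma filling_content v : (v < k)%N ->
  content lam mu T v.+1 = nth 0%N (jumps mu N) v.
Proof.
move=> vk; apply/eqP; rewrite -(eqn_add2r (psum (level mu N v) k)) jumpE //.
apply/eqP; rewrite /content -sum1_card /=.
rewrite (eq_bigl (fun b : 'I_k * 'I_m => true &&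
  (in_skew lam mu b.1 b.2 && (T (b.1, b.2) == v.+1 :> nat)))); last by case.
rewrite -(pair_big_dep xpredT (fun r c => in_skew lam mu r c && (T (r, c) == v.+1 :> nat))
  (fun _ _ => 1%N)) /=.
rewrite /psum -big_split /=; apply: eq_bigr => r _.
by rewrite -filling_row // -sum1_card.
Qed.

Definition row_word T (r : 'I_k) : seq nat :=
  [seq val (T (r, c)) | c <- rev (enum 'I_m) & in_skew lam mu r c].

Lemma count_row_word (r : 'I_k) v : (v < k)%N ->
  (count_mem v.+1 (row_word T r) + level mu N v r = level mu N v.+1 r)%N.
Proof.
move=> vk; rewrite -filling_row //; congr (_ + _)%N.
rewrite count_map count_filter count_rev.
have -> (P : pred 'I_m) : count P (enum 'I_m) = #|P| by rewrite cardE enumT -size_filter.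
by apply: eq_card => c; rewrite !inE /= andbC.
Qed.

Lemma sorted_row_word (r : 'I_k) : sorted geq (row_word T r).
Proof.
apply: (@homo_sorted_in _ _ (in_skew lam mu r) (fun c => val (T (r, c)))
  (fun c c' : 'I_m => (c' <= c)%N)).
- by move=> c c' rc rc' cc'; case: tT => _ + _; apply.
- exact: filter_all.
apply: sorted_filter; first by move=> a b c ab bc; apply: leq_trans bc ab.
rewrite rev_sorted.
have -> : sorted (fun c c' : 'I_m => (c <= c')%N) (enum 'I_m) = sorted leq (map val (enum 'I_m)).
  by rewrite sorted_map.
by rewrite val_enum_ord iota_sorted.
Qed.

Lemma count_rows r v : (r <= k)%N -> (v < k)%N ->
  (count_mem v.+1 (flatten (take r [seq row_word T x | x <- enum 'I_k]))
   + psum (level mu N v) r = psum (level mu N v.+1) r)%N.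
Proof.
have sz : size [seq row_word T x | x <- enum 'I_k] = k by rewrite size_map size_enum_ord.
elim: r => [|r IHr] rk vk; first by rewrite take0 !psum0.
rewrite (take_nth [::]) ?sz // flatten_rcons count_cat !psumS.
rewrite (nth_map (Ordinal rk)) ?size_enum_ord //.
rewrite -[X in nth _ _ X]/(val (Ordinal rk)) nth_ord_enum.
have := count_row_word (Ordinal rk) vk; have := IHr (ltnW rk) vk.
by rewrite /=; lia.
Qed.

(** Inside a row the word decreases weakly, so among the prefixes ending in that row
    the one cut after the last letter [i + 2] is the worst for the letters
    [i + 1] and [i + 2]: it contains the letters [i + 2] of all rows up to this
    one and the letters [i + 1] of the rows above only. *)
Lemma lattice_word_chain : lattice_word (word lam mu T) <-> lattice_chain mu N.
Proof.
pose ss := [seq row_word T x | x <- enum 'I_k].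
have sz : size ss = k by rewrite size_map size_enum_ord.
have ssE (r : 'I_k) : nth [::] ss r = row_word T r.
  by rewrite (nth_map r) ?size_enum_ord // nth_ord_enum.
rewrite -[word lam mu T]/(flatten ss); split.
  move/lattice_wordP => H; apply/forallP => -[r i]; rewrite /violation /=.
  case: (ltnP i.+1 k) => //= ik; rewrite /overflow -leqNgt !psumS.
  pose n := count (leq i.+2) (row_word T r).
  have := H i (size (flatten (take r ss)) + n)%N.
  have -> : take (size (flatten (take r ss)) + n) (flatten ss) =
      flatten (take r ss) ++ [seq y <- row_word T r | leq i.+2 y].
    rewrite -{2}(cat_take_drop r ss) flatten_cat takeD take_size_cat // drop_size_cat //.
    rewrite (drop_nth [::]) ?sz //= ssE takel_cat; last exact: count_size.
    by rewrite take_sorted_geq // sorted_row_word.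
  rewrite !count_cat !count_filter.
  have -> : count (predI (pred1 i.+2) (leq i.+2)) (row_word T r) =
      count_mem i.+2 (row_word T r).
    by apply: eq_count => y /=; case: eqP => // ->; rewrite leqnn.
  have -> : count (predI (pred1 i.+1) (leq i.+2)) (row_word T r) = 0%N.
    rewrite -(count_pred0 (row_word T r)).
    by apply: eq_count => y /=; case: eqP => // ->; rewrite ltnn.
  have := count_row_word r ik; have := count_rows (ltnW (ltn_ord r)) ik.
  by have := count_rows (ltnW (ltn_ord r)) (ltnW ik); rewrite -/ss; lia.
move=> lN'; apply/lattice_wordP => i j.
have [ki|ik] := leqP k i.+1.
  (* Entries are at most [k], so the letter [i.+2] does not occur. *)
  rewrite (_ : count_mem i.+2 _ = 0%N) //; apply/eqP; rewrite -leqn0 leqNgt -has_count.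
  apply/hasPn => y /mem_take /flattenP[w /mapP[r _ ->] /mapP[c _ ->]] /=.
  by rewrite neq_ltn (leq_trans (ltn_ord _)).
have k0 : (0 < size ss)%N by rewrite sz (leq_trans _ ik).
have [r [n [+ ->]]] := take_flatten j k0; rewrite sz => rk.
rewrite -[r]/(val (Ordinal rk)) ssE !count_cat.
have := forallP lN' (Ordinal rk, Ordinal (ltnW ik)).
rewrite /violation /= ik /= /overflow -leqNgt !psumS.
have := count_row_word (Ordinal rk) ik; have := count_rows (ltnW rk) ik.
have := count_rows (ltnW rk) (ltnW ik); rewrite -/ss.
have : (count_mem i.+2 (take n (row_word T (Ordinal rk))) <=
        count_mem i.+2 (row_word T (Ordinal rk)))%N.
  by rewrite -{2}(cat_take_drop n (row_word _ _)) count_cat leq_addr.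
rewrite /=.
move: (count_mem _ (take n _)) (count_mem i.+1 (take n _)) (count_mem i.+2 (row_word _ _))
  (count_mem i.+1 (flatten _)) (count_mem i.+2 (flatten _)) => a b c d e.
move: (level mu N i.+1 r) (level mu N i.+2 r) (psum (level mu N i.+2) r)
  (psum (level mu N i.+1) r) (psum (level mu N i) r) => f g h p q.
by lia.
Qed.

End Filled.
End Chain.

Section Tableau.
Variable T : filling k m.
Hypothesis tT : is_tableau lam mu T.
Hypothesis le : part_le mu lam.

(** The boxes of row [x] with entry at most [v] form an initial segment of the
    row of the skew shape; this is where that segment ends. *)
Definition filled_row (v x : nat) : nat :=
  if insub x is Some r
  then (mu r + #|[pred c : 'I_m | in_skew lam mu r c & (T (r, c) <= v)%N]|)%N else 0%N.

Lemma filled_rowE v (r : 'I_k) : filled_row v r =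
  (mu r + #|[pred c : 'I_m | in_skew lam mu r c & (T (r, c) <= v)%N]|)%N.
Proof. by rewrite /filled_row valK. Qed.

Lemma filled_row_out v x : (k <= x)%N -> filled_row v x = 0%N.
Proof. by move=> kx; rewrite /filled_row insubF // ltnNge kx. Qed.

Lemma filled_rowP (r : 'I_k) (c : 'I_m) v : in_skew lam mu r c ->
  (T (r, c) <= v)%N = (c < filled_row v r)%N.
Proof.
move=> rc; rewrite filled_rowE.
apply: (@initial_segment m (fun c => (T (r, c) <= v)%N) (mu r) (lam r) c) => //.
  by rewrite -ltnS.
move=> x y mx xy yl; apply: leq_trans; case: tT => _ + _; apply=> //; apply/andP; split=> //.
  exact: leq_ltn_trans xy yl.
exact: leq_trans mx xy.
Qed.

Lemma filled_row0 x : filled_row 0 x = row_len mu x.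
Proof.
have [xk|kx] := ltnP x k; last by rewrite row_len_out // filled_row_out.
rewrite -[x]/(val (Ordinal xk)) filled_rowE row_len_ord eq_card0 ?addn0 // => c.
rewrite !inE; apply/negP => /andP[rc]; rewrite leqNgt.
by case: tT => -> _ _; rewrite rc.
Qed.

Lemma filled_row_last x : filled_row k x = row_len lam x.
Proof.
have [xk|kx] := ltnP x k; last by rewrite row_len_out // filled_row_out.
rewrite -[x]/(val (Ordinal xk)) filled_rowE row_len_ord.
rewrite -[RHS](subnKC (forallP le (Ordinal xk))); congr (_ + _)%N.
rewrite -(@card_skew_row m); last by rewrite -ltnS.
by apply: eq_card => c; rewrite !inE -ltnS ltn_ord andbT.
Qed.

Lemma filled_row_le v w x : (v <= w)%N -> (filled_row v x <= filled_row w x)%N.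
Proof.
move=> vw; rewrite /filled_row; case: insub => // r; rewrite leq_add2l.
apply/subset_leq_card/fintype.subsetP => c; rewrite !inE => /andP[-> /=] Tv.
exact: leq_trans Tv vw.
Qed.

Lemma filled_row_max v x : (filled_row v x <= row_len lam x)%N.
Proof.
have [vk|kv] := leqP v k; first by rewrite -filled_row_last filled_row_le.
rewrite -filled_row_last /filled_row; case: insub => // r; rewrite leq_add2l.
apply/subset_leq_card/fintype.subsetP => c; rewrite !inE => /andP[-> _] /=.
by rewrite -ltnS.
Qed.

(** A box of row [x + 1] with entry at most [v + 1] lies under a box of [mu]
    or, by column strictness, under one with entry at most [v]. *)
Lemma filled_row_interlace v : interlace (filled_row v) (filled_row v.+1).
Proof.
move=> x; split; first exact: filled_row_le.
have [xk|kx] := ltnP x.+1 k; last by rewrite filled_row_out.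
have xk0 := ltnW xk; rewrite leqNgt; apply/negP => lt.
have cm : (filled_row v x < m)%N.
  by apply: leq_trans lt _; apply: leq_trans (filled_row_max _ _) (row_len_max _ _).
have mu_le : (row_len mu x <= filled_row v x)%N by rewrite -filled_row0 filled_row_le.
pose c := Ordinal cm; pose r := Ordinal xk0; pose r' := Ordinal xk.
have cl : (c < row_len lam x.+1)%N by apply: leq_trans lt (filled_row_max _ _).
have rc' : in_skew lam mu r' c.
  rewrite /in_skew -!row_len_ord cl andbT.
  by apply: leq_trans mu_le; apply: row_len_anti.
have rc : in_skew lam mu r c.
  rewrite /in_skew -!row_len_ord mu_le /=.
  by apply: leq_trans cl _; apply: row_len_anti.
have := filled_rowP v.+1 rc'; rewrite lt => T'.
have := filled_rowP v rc; rewrite ltnn => /negbT.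
case: tT => _ _ /(_ r r' c rc rc' (ltnSn x)) TT.
by rewrite -ltnNge => vT; move: (leq_trans TT T'); rewrite ltnS leqNgt vT.
Qed.

Definition filling_chain : k.-tuple part := [tuple part_of k m (filled_row j.+1) | j < k].

Lemma level_filling_chain j x : (j <= k)%N -> level mu filling_chain j x = filled_row j x.
Proof.
case: j => [|j] jk; first by rewrite filled_row0.
have -> : level mu filling_chain j.+1 = row_len (tnth filling_chain (Ordinal jk)).
  by rewrite (tnth_nth mu).
rewrite tnth_mktuple row_part_of //= => [y||y ky].
- case: (filled_row_interlace j y) => + _; case: (filled_row_interlace j y) => _.
  exact: leq_trans.
- exact: leq_trans (filled_row_max _ _) (row_len_max _ _).
exact: filled_row_out.
Qed.

Lemma filling_chain_chain : is_chain mu filling_chain.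
Proof.
apply/chainP => j jk x; rewrite !level_filling_chain ?(ltnW jk) //.
exact: filled_row_interlace.
Qed.

Lemma filling_chain_last : last mu filling_chain = lam.
Proof.
apply: row_len_inj => x; rewrite (last_nth mu) size_tuple.
by rewrite -/(level mu filling_chain k) level_filling_chain // filled_row_last.
Qed.

Lemma filling_chain_fills : fills T filling_chain.
Proof. by move=> r c v rc vk; rewrite level_filling_chain // -filled_rowP. Qed.
End Tableau.

Lemma fills_inj T T' N : is_tableau lam mu T -> is_tableau lam mu T' ->
  fills T N -> fills T' N -> T = T'.
Proof.
move=> [t0 _ _] [t0' _ _] f f'; apply/ffunP => -[r c]; apply/val_inj/eqP => /=.
case: (boolP (in_skew lam mu r c)) => rc; last first.
  move: (t0 r c) (t0' r c); rewrite (negbTE rc) => /negbT + /negbT.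
  by rewrite -!leqNgt !leqn0 => /eqP -> /eqP ->.
have Tk : (T (r, c) <= k)%N by rewrite -ltnS.
have Tk' : (T' (r, c) <= k)%N by rewrite -ltnS.
by rewrite eqn_leq (f _ _ _ rc Tk') -(f' _ _ _ rc Tk') leqnn
  (f' _ _ _ rc Tk) -(f _ _ _ rc Tk) leqnn.
Qed.

Lemma fills_chain_inj T N N' : is_chain mu N -> last mu N = lam ->
  is_chain mu N' -> last mu N' = lam -> fills T N -> fills T N' -> N = N'.
Proof.
move=> cN lN cN' lN' f f'; apply: (@level_inj _ _ mu) => j x jk.
have [xk|kx] := ltnP x k; last by rewrite /level !row_len_out.
have [a b] := chain_skew cN lN (Ordinal xk) jk.
have [a' b'] := chain_skew cN' lN' (Ordinal xk) jk.
have key (c : nat) : (mu (Ordinal xk) <= c < lam (Ordinal xk))%N ->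
    (c < level mu N j x)%N = (c < level mu N' j x)%N.
  move=> cx; have cm : (c < m)%N.
    by case/andP: cx => _ /leq_trans; apply; rewrite -ltnS.
  by rewrite -(f (Ordinal xk) (Ordinal cm)) // -(f' (Ordinal xk) (Ordinal cm)).
apply/eqP; rewrite eqn_leq; apply/andP; split; rewrite leqNgt; apply/negP => lt.
  by have := key (level mu N' j x); rewrite lt ltnn a' /= => /(_ (leq_trans lt b)).
by have := key (level mu N j x); rewrite lt ltnn a /= => /(_ (leq_trans lt b')).
Qed.

End Fillings.

Lemma card_inverse_in (S U : finType) (P : pred S) (Q : pred U) (f : S -> U) (g : U -> S) :
  (forall x, P x -> Q (f x) /\ g (f x) = x) ->
  (forall y, Q y -> P (g y) /\ f (g y) = y) -> #|P| = #|Q|.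
Proof.
move=> fP gQ; rewrite -!sum1_card (reindex_onto f g) /=; last by move=> y /gQ[].
apply: eq_bigl => x; rewrite !unfold_in.
apply/idP/andP => [/fP[Qx E]|[/gQ[Px _] /eqP E]]; first by rewrite E.
by rewrite E in Px.
Qed.

(** If [mu] is not contained in the shape there is no chain, in accordance with
    the value [0] of [LR_number]. *)
Lemma LR_numberE k m (lam mu nu : rect_part k m) :
  LR_number lam mu nu = #|LR_chains mu (dual_part lam) (dual_part nu)|.
Proof.
rewrite /LR_number; case: ifP => [le|/negbT nle]; last first.
  apply/esym/eq_card0 => N; apply/negP => /and4P[cN /eqP lN _ _].
  case/negP: nle; apply/forallP => r.
  have [a b] := chain_skew cN lN r (leq0n k); exact: leq_trans a b.
set L := dual_part lam; set c := dual_part nu.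
apply: (@card_inverse_in _ _ _ _ (filling_chain L mu) (chain_filling L mu)).
  move=> T /asboolP[tT wT cT].
  have cN := filling_chain_chain tT le; have lN := filling_chain_last tT le.
  have fN := filling_chain_fills tT le; split; last first.
    apply: (@fills_inj _ _ L mu _ _ (filling_chain L mu T)) => //.
      exact: chain_filling_tableau.
    exact: chain_filling_fills.
  rewrite /LR_chains /= cN lN eqxx /=; apply/andP; split.
    by apply/forallP => i; rewrite -(filling_content cN lN fN) // cT.
  exact/(lattice_word_chain cN lN tT fN).
move=> N /and4P[cN /eqP lN hN latN].
have tT := chain_filling_tableau cN lN; have fN := chain_filling_fills cN lN.
split.
  apply/asboolP; split=> //; first exact/(lattice_word_chain cN lN tT fN).
  by move=> i; rewrite (filling_content cN lN fN) // (eqP (forallP hN i)).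
apply: (@fills_chain_inj _ _ L mu (chain_filling L mu N)) => //.
- exact: filling_chain_chain.
- exact: filling_chain_last.
exact: filling_chain_fills.
Qed.

(** * One-row partitions *)

Section PieriStrips.
Variables k m : nat.
Implicit Types lam mu : rect_part k m.

Lemma horizontal_strip_bound lam mu p : horizontal_strip lam mu p -> (p <= m)%N.
Proof.
rewrite horizontal_stripE => /andP[/hstripP H /eqP].
have bd n : (psum (row_len lam) n <= psum (row_len mu) n + m)%N.
  case: n => [|n]; first by rewrite psum0.
  suff : (psum (row_len lam) n.+1 <= psum (row_len mu) n + m)%N.
    by move/leq_trans; apply; rewrite leq_add2r psumS leq_addr.
  elim: n => [|n IHn]; first by rewrite psumS !psum0 row_len_max.
  by rewrite psumS (psumS (row_len mu)); case: (H n) => _; lia.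
by rewrite !weightE; have := bd k; lia.
Qed.

Lemma horizontal_strip0 lam mu : horizontal_strip lam mu 0 = (lam == mu).
Proof.
rewrite horizontal_stripE addn0; apply/andP/eqP => [[/hstripP H /eqP w]|->]; last first.
  split=> //; apply/hstripP => x; split=> //; exact: row_len_anti (leqnSn x).
have [_] := leqif_sum (fun (i : 'I_k) (_ : true) => leqif_eq (H i).1).
rewrite -[X in X == _]/(psum (row_len mu) k) -[X in _ == X]/(psum (row_len lam) k).
rewrite -!weightE w eqxx => /esym/forallP eq_row.
apply/val_inj/ffunP => i; apply/val_inj => /=.
by rewrite -!row_len_ord; apply/esym/eqP/(implyP (eq_row i)).
Qed.

Hypothesis k_gt0 : (0 < k)%N.

Lemma psum_two (f : nat -> nat) : (forall x, (1 < x)%N -> f x = 0%N) ->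
  (forall x, (k <= x)%N -> f x = 0%N) -> psum f k = (f 0 + f 1)%N.
Proof.
move=> f2 fk; case: k k_gt0 fk => // -[|n] _ fk.
  by rewrite psumS psum0 add0n (fk 1%N) ?addn0.
elim: n {fk} => [|n IHn]; first by rewrite !psumS psum0.
by rewrite psumS IHn (f2 n.+2) ?addn0.
Qed.

Lemma weight_row (p : 'I_m.+1) : weight (row_part k p) = p.
Proof.
rewrite weightE psum_two => [|x x1|x]; try exact: row_len_out.
  by rewrite !row_part_row k_gt0 /= addn0.
by rewrite row_part_row; case: x x1.
Qed.

(** A partition reached from a row has at most two rows, of total length [p + q]; its
    second row is at most [p] iff its first row is at least [q]. *)
Lemma horizontal_strip_row_swap (p q : 'I_m.+1) lam :
  horizontal_strip lam (row_part k p) q -> horizontal_strip lam (row_part k q) p.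
Proof.
rewrite !horizontal_stripE !weight_row => /andP[/hstripP H /eqP wE].
rewrite wE addnC eqxx andbT.
have l2 x : (1 < x)%N -> row_len lam x = 0%N.
  case: x => [|[|x]] // _; case: (H x.+1) => _.
  by rewrite row_part_row leqn0 => /eqP.
have := wE; rewrite weightE (psum_two l2); last exact: row_len_out.
have := H 0%N; rewrite !row_part_row k_gt0 /= => H0 E.
apply/hstripP => x; rewrite row_part_row k_gt0 andbT.
case: x => [|x] /=; last by rewrite (l2 x.+2).
by lia.
Qed.

End PieriStrips.

(** * Multiplication in a ring with a Pieri rule *)

Local Open Scope ring_scope.

Lemma mulr_signz (A : pzRingType) (x : A) (b : bool) : (-1) ^+ b * x = x *~ (-1) ^+ b.
Proof. by case: b; rewrite ?expr0 ?expr1 ?mul1r ?mulN1r ?mulr1z // mulrNz mulr1z. Qed.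

Section SchubertRing.
Variables (k m : nat) (A : pzRingType) (sigma : rect_part k m -> A).
Notation part := (rect_part k m).
Hypothesis k_gt0 : (0 < k)%N.
Hypothesis basis : forall x : A,
  exists! d : {ffun part -> int}, x = \sum_nu sigma nu *~ d nu.
Hypothesis pieri : forall (p : 'I_m.+1) (lam : part),
  sigma (row_part k p) * sigma lam =
  \sum_(lam' | horizontal_strip lam' lam p) sigma lam'.
Implicit Types (x y : A) (lam mu nu : part).

Definition coef x : {ffun part -> int} := projT1 (cid (basis x)).

Lemma coefP x : x = \sum_nu sigma nu *~ coef x nu.
Proof. by rewrite /coef; case: cid => d /= []. Qed.

Lemma coef_sum (f : part -> int) nu : coef (\sum_mu sigma mu *~ f mu) nu = f nu.
Proof.
have [d [_ dU]] := basis (\sum_mu sigma mu *~ f mu).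
have -> : coef (\sum_mu sigma mu *~ f mu) = [ffun mu => f mu]; last by rewrite ffunE.
rewrite -(dU _ (coefP _)); apply: dU.
by apply: eq_bigr => mu _; rewrite ffunE.
Qed.

Lemma coef_inj x y : (forall nu, coef x nu = coef y nu) -> x = y.
Proof. by move=> xy; rewrite (coefP x) (coefP y); apply: eq_bigr => nu _; rewrite xy. Qed.

Lemma coefD x y nu : coef (x + y) nu = coef x nu + coef y nu.
Proof.
rewrite -[RHS](coef_sum (fun mu => coef x mu + coef y mu)); congr (coef _ _).
rewrite {1}(coefP x) {1}(coefP y) -big_split; apply: eq_bigr => mu _.
by rewrite mulrzDr.
Qed.

Lemma coefMz x (z : int) nu : coef (x *~ z) nu = coef x nu * z.
Proof.
rewrite -[RHS](coef_sum (fun mu => coef x mu * z)); congr (coef _ _).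
by rewrite {1}(coefP x) mulrz_suml; apply: eq_bigr => mu _; rewrite mulrzA.
Qed.

Lemma coef0 nu : coef 0 nu = 0.
Proof. by rewrite -(mulr0z 0) coefMz mulr0. Qed.

Lemma coef_bigsum (I : Type) (r : seq I) (P : pred I) (F : I -> A) nu :
  coef (\sum_(i <- r | P i) F i) nu = \sum_(i <- r | P i) coef (F i) nu.
Proof. by apply: (big_morph (fun x => coef x nu)) => [x y|]; rewrite ?coefD ?coef0. Qed.

Lemma coef_sigma lam nu : coef (sigma lam) nu = (lam == nu)%:Z.
Proof.
rewrite -[RHS](coef_sum (fun mu => (lam == mu)%:Z)); congr (coef _ _).
rewrite (bigD1 lam) //= eqxx mulr1z big1 ?addr0 // => mu.
by rewrite eq_sym => /negbTE ->; rewrite mulr0z.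
Qed.

Lemma coefM x y nu : coef (x * y) nu = \sum_mu coef y mu * coef (x * sigma mu) nu.
Proof.
rewrite {1}(coefP y) mulr_sumr coef_bigsum; apply: eq_bigr => mu _.
by rewrite mulrzAr coefMz mulrC.
Qed.

Definition special (p : nat) : A :=
  if (p <= m)%N then sigma (row_part k (inord p)) else 0.

Lemma special_pieri p lam : special p * sigma lam =
  \sum_(lam' | horizontal_strip lam' lam p) sigma lam'.
Proof.
rewrite /special; case: leqP => pm; first by rewrite pieri inordK.
rewrite mul0r big_pred0 // => lam'; apply/negbTE/negP => /horizontal_strip_bound.
by rewrite leqNgt pm.
Qed.

(** The Pieri rule for [p = 0] makes this class a left identity on the basis,
    hence on [1]. *)
Lemma sigma_empty : sigma (empty_part k m) = 1.
Proof.
rewrite -[LHS]mulr1 {1}(coefP 1) mulr_sumr {2}(coefP 1); apply: eq_bigr => mu _.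
by rewrite mulrzAr pieri (big_pred1 mu) // => lam; rewrite /= horizontal_strip0.
Qed.

Lemma special_comm p q : GRing.comm (special p) (special q).
Proof.
rewrite /GRing.comm /special.
case: (leqP q m) => qm; last by rewrite mul0r mulr0.
case: (leqP p m) => pm; last by rewrite mul0r mulr0.
rewrite !pieri; apply: eq_bigl => lam; rewrite !inordK //.
apply/idP/idP => h.
  have := @horizontal_strip_row_swap k m k_gt0 (inord q) (inord p) lam.
  by rewrite !inordK //; apply.
have := @horizontal_strip_row_swap k m k_gt0 (inord p) (inord q) lam.
by rewrite !inordK //; apply.
Qed.

(** The head of the list is the size of the first strip; commutativity brings
    that factor next to [sigma mu]. *)
Lemma special_prod (a : seq nat) n mu : size a = n ->
  (\prod_(p <- a) special p) * sigma mu =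
  \sum_(t : n.-tuple part | path (@hstrip k m) mu t && (jumps mu t == a))
     sigma (last mu t).
Proof.
elim: a n mu => [|p a IHa] [|n] mu //= => [_|[an]].
  rewrite big_nil mul1r (big_pred1 [tuple]) //= => t.
  by rewrite (tuple0 t) /= eqxx.
rewrite big_cons; have -> : special p * (\prod_(q <- a) special q) =
    (\prod_(q <- a) special q) * special p.
  by apply: commr_prod => q _; apply: special_comm.
rewrite -mulrA special_pieri mulr_sumr.
rewrite (eq_bigr _ (fun lam' _ => IHa n lam' an)).
rewrite pair_big_dep /=.
rewrite [RHS](reindex (fun y : part * n.-tuple part => [tuple of y.1 :: y.2])) /=; last first.
  exists (fun t => (thead t, [tuple of behead t])) => [[y t] _|t _] /=.
    by rewrite theadE; congr pair; apply/val_inj.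
  by rewrite [RHS]tuple_eta; apply/val_inj.
apply: eq_bigl => -[y t] /=; rewrite eqseq_cons horizontal_stripE -!andbA.
case: (boolP (hstrip mu y)) => //= /hstrip_weight w.
have -> : (weight y == weight mu + p)%N = (weight y - weight mu == p)%N.
  by apply/eqP/eqP; lia.
by rewrite andbCA.
Qed.

(** The determinant of [special (lam i + j - i)] over all [i] and [j], expanded
    over the permutations [s] assigning to column [i] the row [s i].  The test
    discards negative indices, for which the special class vanishes. *)
Definition giambelli lam : A :=
  \sum_(s : 'S_k) (-1) ^+ s *
    (if [forall i : 'I_k, (s i <= lam (s i) + i)%N]
     then \prod_(i < k) special (lam (s i) + i - s i) else 0).

Lemma giambelli_term lam (s : 'S_k) mu :
  (if [forall i : 'I_k, (s i <= lam (s i) + i)%N]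
   then \prod_(i < k) special (lam (s i) + i - s i) else 0) * sigma mu =
  \sum_(t : k.-tuple part | is_chain mu t && shifted_content mu lam s t)
     sigma (last mu t).
Proof.
case: ifP => [/forallP le|/negbT/forallPn[i lt]]; last first.
  rewrite mul0r big_pred0 // => t; apply/negbTE/negP => /andP[_ /forallP/(_ i)/eqP e].
  by move: lt; rewrite -e leq_addl.
pose a := [seq (lam (s i) + i - s i)%N | i <- enum 'I_k].
have sa : size a = k by rewrite size_map size_enum_ord.
transitivity ((\prod_(p <- a) special p) * sigma mu).
  by rewrite big_map enumT.
rewrite (special_prod mu sa); apply: eq_bigl => t; congr (_ && _).
have sj : size (jumps mu t) = k by rewrite size_pairmap size_tuple.
have an (i : 'I_k) : nth 0%N a i = (lam (s i) + i - s i)%N.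
  by rewrite (nth_map i) ?size_enum_ord // nth_ord_enum.
apply/eqP/forallP => [-> i|H]; first by rewrite an subnK.
apply: (@eq_from_nth _ 0%N); rewrite ?sa ?sj // => i ik.
rewrite (an (Ordinal ik)); have /eqP := H (Ordinal ik).
by move <-; rewrite addnK.
Qed.

Lemma coef_giambelli lam mu nu :
  coef (giambelli lam * sigma mu) nu = #|LR_chains mu nu lam|%:Z.
Proof.
rewrite -signed_count mulr_suml coef_bigsum.
transitivity (\sum_(s : 'S_k)
    \sum_(t : k.-tuple part | is_chain mu t && shifted_content mu lam s t)
       (if last mu t == nu then (-1) ^+ s else 0 : int)).
  apply: eq_bigr => s _; rewrite -mulrA giambelli_term mulr_signz coefMz coef_bigsum.
  rewrite mulr_suml; apply: eq_bigr => t _; rewrite coef_sigma.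
  by case: eqP => _; rewrite ?mul1r ?mul0r.
rewrite pair_big_dep [RHS](eq_bigl (fun x : 'S_k * k.-tuple part =>
  (is_chain mu x.2 && shifted_content mu lam x.1 x.2) && (last mu x.2 == nu))).
  by rewrite [RHS]big_mkcondr.
by move=> x /=; rewrite -andbA [X in _ && X]andbC.
Qed.

(** Multiply by [1], the class of the empty partition, and count the chains
    that start there. *)
Lemma giambelliE lam : giambelli lam = sigma lam.
Proof.
apply: coef_inj => nu.
by rewrite -[giambelli lam]mulr1 -sigma_empty coef_giambelli card_LR_chains_empty coef_sigma.
Qed.

Lemma coef_mul_sigma lam mu nu :
  coef (sigma lam * sigma mu) nu = #|LR_chains mu nu lam|%:Z.
Proof. by rewrite -giambelliE coef_giambelli. Qed.

Lemma comm_giambelli x lam :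
  (forall p, GRing.comm x (special p)) -> GRing.comm x (giambelli lam).
Proof.
move=> xc; apply: commr_sum => s _; apply: commrM; first exact: commr_sign.
by case: ifP => _; [apply: commr_prod => i _|exact: commr0].
Qed.

Lemma sigma_comm lam mu : sigma lam * sigma mu = sigma mu * sigma lam.
Proof.
rewrite -!giambelliE; apply: comm_giambelli => p; apply/commr_sym/comm_giambelli => q.
exact: special_comm.
Qed.

(** Adjointness for the bilinear form in which [sigma lam] and [sigma nu] pair
    to [1] if [nu] is the complement of [lam] and to [0] otherwise. *)
Definition self_adjoint x : Prop := forall lam nu,
  coef (x * sigma lam) nu = coef (x * sigma (dual_part nu)) (dual_part lam).

Lemma self_adjoint_special p : self_adjoint (special p).
Proof.
move=> lam nu; rewrite !special_pieri !coef_bigsum.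
have cE mu nu' : \sum_(lam' | horizontal_strip lam' mu p) coef (sigma lam') nu' =
    (horizontal_strip nu' mu p)%:Z.
  rewrite big_mkcond (bigD1 nu') //= coef_sigma eqxx big1 ?addr0; first by case: ifP.
  by move=> i ni; case: ifP => // _; rewrite coef_sigma (negbTE ni).
by rewrite !cE horizontal_strip_dual.
Qed.

Lemma self_adjoint1 : self_adjoint 1.
Proof.
move=> lam nu; rewrite !mul1r !coef_sigma (inj_eq (inv_inj (@dual_partK k m))).
by rewrite eq_sym.
Qed.

Lemma self_adjointM x y : x * y = y * x ->
  self_adjoint x -> self_adjoint y -> self_adjoint (x * y).
Proof.
move=> xy xa ya lam nu; rewrite {2}xy -!mulrA !coefM.
rewrite [RHS](reindex_inj (inv_inj (@dual_partK k m))); apply: eq_bigr => mu _.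
by rewrite mulrC xa ya.
Qed.

Lemma self_adjoint_giambelli lam : self_adjoint (giambelli lam).
Proof.
move=> mu nu; rewrite !mulr_suml !coef_bigsum; apply: eq_bigr => s _.
rewrite -!mulrA !mulr_signz !coefMz; congr (_ * _).
case: ifP => _; last by rewrite !mul0r !coef0.
move: mu nu; rewrite -/(self_adjoint _).
elim: (index_enum _) => [|i r IHr]; first by rewrite big_nil; exact: self_adjoint1.
rewrite big_cons; apply: self_adjointM => //; last exact: self_adjoint_special.
by apply: commr_prod => j _; apply: special_comm.
Qed.

(** Move [sigma mu] across the pairing: the coefficient of [nu] in
    [sigma mu * sigma lam] is that of [lam^v] in [sigma mu * sigma nu^v]. *)
Lemma coef_mul_dual lam mu nu : coef (sigma lam * sigma mu) nu =
  #|LR_chains mu (dual_part lam) (dual_part nu)|%:Z.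
Proof.
rewrite -coef_mul_sigma sigma_comm -giambelliE self_adjoint_giambelli giambelliE.
by rewrite sigma_comm.
Qed.

Theorem schubert_product lam mu :
  sigma lam * sigma mu = \sum_nu sigma nu *+ LR_number lam mu nu.
Proof.
apply: coef_inj => nu; rewrite coef_mul_dual -LR_numberE.
rewrite -[LHS](coef_sum (fun nu => (LR_number lam mu nu)%:Z)); congr (coef _ _).
Qed.

End SchubertRing.

Theorem theorem1 (R : realType) (k n : nat) (hk : (1 <= k <= n - 1)%N)
  (E : 'M[R[i]]_n) (hE : E \in unitmx)
  (sigma : rect_part k (n - k) -> cohomology R (grassmannian R k n))
  (sigma_schubert : forall lam, schubert_class E lam (sigma lam))
  (sigma_basis : forall x : cohomology R (grassmannian R k n),
     exists! d : {ffun rect_part k (n - k) -> int},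
       x = \sum_nu sigma nu *~ d nu)
  (pieri : forall (p : 'I_(n - k).+1) (lam : rect_part k (n - k)),
     sigma (row_part k p) * sigma lam =
     \sum_(lam' | horizontal_strip lam' lam p) sigma lam')
  (lam mu : rect_part k (n - k)) :
  sigma lam * sigma mu = \sum_nu sigma nu *+ LR_number lam mu nu.
Proof.
have k_gt0 : (0 < k)%N by case/andP: hk.
exact: (schubert_product k_gt0 sigma_basis pieri).
Qed.
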